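(* Let $\mathcal{H}_1,\mathcal{H}_2$ be Hilbert spaces, let $\mathcal{S}\subseteq\mathcal{H}_1$ and $\mathcal{T}\subseteq\mathcal{H}_2$ be closed subspaces, let $A\in L(\mathcal{H}_1,\mathcal{H}_2)$ be $(\mathcal{S},\mathcal{T})$-complementable, and let $L\in L(\mathcal{H}_1,\mathcal{H}_2)$ be an operator such that $R(L)=\mathcal{T}$ and $R(L^* )=\mathcal{S}$. Then there exists $n\in\mathbb{N}$ such that: 1. $A$ and $nL$ are parallel summable; 2. $A_{/(\mathcal{S},\mathcal{T})}\in\mathcal{D}_{-nL}$; 3. $(A:nL)\div nL=A_{/(\mathcal{S},\mathcal{T})}$.
   Context: $L(\mathcal{H}_1,\mathcal{H}_2)$ is the space of bounded linear operators; $R(\cdot)$, $N(\cdot)$ denote range and nullspace; $|T|=(T^*T)^{1/2}$. Block form: for closed subspaces $\mathcal{S}\subseteq\mathcal{H}_1$, $\mathcal{T}\subseteq\mathcal{H}_2$, with $P_{\mathcal{M}}$ the orthogonal projection onto $\mathcal{M}$, write $A_{11}=P_{\mathcal{T}}A|_{\mathcal{S}}$, $A_{12}=P_{\mathcal{T}}A|_{\mathcal{S}^\perp}$, $A_{21}=P_{\mathcal{T}^\perp}A|_{\mathcal{S}}$, $A_{22}=P_{\mathcal{T}^\perp}A|_{\mathcal{S}^\perp}$. $A$ is $(\mathcal{S},\mathcal{T})$-complementable if $R(A_{21})\subseteq R(A_{22})$ and $R(A_{12}^* )\subseteq R(A_{22}^* )$. It is $(\mathcal{S},\mathcal{T})$-weakly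 complementable if $R(A_{21})\subseteq R(|A_{22}^*|^{1/2})$ and $R(A_{12}^* )\subseteq R(|A_{22}|^{1/2})$. Complementability implies weak complementability. Reduced solution: if $R(Y)\subseteq R(X)$, the reduced solution of $XD=Y$ is the unique bounded $D$ with $XD=Y$ and $R(D)\subseteq N(X)^\perp$. Bilateral shorted operator: for $A$ $(\mathcal{S},\mathcal{T})$-weakly complementable, let $A_{22}=U|A_{22}|$ be the polar decomposition, let $E\in L(\mathcal{S},\mathcal{S}^\perp)$ be the reduced solution of $A_{21}=|A_{22}^*|^{1/2}UX$ and $F\in L(\mathcal{T},\mathcal{S}^\perp)$ the reduced solution of $A_{12}^*=|A_{22}|^{1/2}X$. Then $A_{/(\mathcal{S},\mathcal{T})}$ is the operator with block form $\begin{pmatrix}A_{11}-F^*E&0\\ 0&0\end{pmatrix}$ relative to $\mathcal{S}\oplus\mathcal{S}^\perp$ and $\mathcal{T}\oplus\mathcal{T}^\perp$. Parallel summability: $A,B\in L(\mathcal{H}_1,\mathcal{H}_2)$ are parallel summable if $R(A)\subseteq R(A+B)$ and $R(A^* )\subseteq R(A^*+B^* )$. In that case the operator matrix $M=\begin{pmatrix}A&A\\ A&A+B\end{pmatrix}\in L(\mathcal{H}_1\oplus\mathcal{H}_1,\mathcal{H}_2\oplus\mathcal{H}_2)$ is $(\mathcal{H}_1\oplus\{0\},\mathcal{H}_2\oplus\{0\})$-complementable, and the parallel sum $A:B$ is defined by $\begin{pmatrix}A:B&0\\ 0&0\end{pmatrix}=M_{/(\mathcal{H}_1\oplus\{0\},\,\mathcal{H}_2\oplus\{0\})}$.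 Parallel substraction: for $A\in L(\mathcal{H}_1,\mathcal{H}_2)$ let $\mathcal{D}_A=\{C\in L(\mathcal{H}_1,\mathcal{H}_2): R(C-A)=R(A)\text{ and }R((C-A)^* )=R(A^* )\}$. For $C\in\mathcal{D}_A$, the parallel substraction $C\div A$ is the unique operator $X$, parallel summable with $A$, such that $A:X=C$, $R(A+X)=R(A)$ and $R((A+X)^* )=R(A^* )$; one has $C\div A=C:(-A)$. Part 3 includes that $A:nL\in\mathcal{D}_{nL}$, so that the left-hand side is defined. *)

(* Defs.v *)
From HB Require Import structures.
From mathcomp Require Import all_boot all_order all_algebra.
From mathcomp Require Import complex.
From mathcomp Require Import boolp classical_sets functions reals.
From mathcomp Require Import topology normedtype.

Set Implicit Arguments.
Unset Strict Implicit.
Unset Printing Implicit Defensive.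

Import Order.TTheory GRing.Theory Num.Theory.
Import numFieldNormedType.Exports.

Local Open Scope classical_set_scope.
Local Open Scope ring_scope.

HB.mixin Record NormedModule_isHilbert (R : realType) H
    & CompleteNormedModule R[i] H := {
  hdot : {dot H for @Num.conj R[i]} ;
  hdot_norm : forall x : H, hdot x x = `|x| ^+ 2
}.

#[short(type="hilbertType")]
HB.structure Definition Hilbert (R : realType) :=
  {H of CompleteNormedModule R[i] H & NormedModule_isHilbert R H}.

Arguments hdot {R s}.

Section DotNorm.
Variables (C : numClosedFieldType) (V : lmodType C).
Variable d : {dot V for @Num.conj C}.

Lemma dot_CauchySchwarz (u v : V) : `|d u v| ^+ 2 <= d u u * d v v.
Proof.
have [->|v0] := eqVneq v 0; first by rewrite !linear0r normr0 expr0n mulr0.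
have dv : 0 < d v v by rewrite dnorm_gt0.
pose a := d u v / d v v.
have := dnorm_ge0 d (u - a *: v).
rewrite dnormB dnormZ linearZr_LR /=.
have -> : a^* * d u v = `|d u v| ^+ 2 / d v v.
  rewrite /a rmorphM fmorphV /= (CrealP (ger0_real (ltW dv))) normCK.
  by rewrite mulrAC [(_^*) * _]mulrC.
have -> : `|a| ^+ 2 * d v v = `|d u v| ^+ 2 / d v v.
  rewrite /a normrM normfV (ger0_norm (ltW dv)) exprMn -mulrA; congr (_ * _).
  by rewrite expr2 -mulrA mulVf ?mulr1 ?gt_eqF.
have r : `|d u v| ^+ 2 / d v v \is Num.real.
  by rewrite ger0_real// divr_ge0 ?exprn_ge0 ?dnorm_ge0.
rewrite (CrealP r) opprD addrA addrK subr_ge0.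
by rewrite ler_pdivrMr.
Qed.

Lemma dot_normD (u v : V) :
  sqrtC (d (u + v) (u + v)) <= sqrtC (d u u) + sqrtC (d v v).
Proof.
have u0 := dnorm_ge0 d u; have v0 := dnorm_ge0 d v.
rewrite -(@ler_pXn2r _ 2%N) ?nnegrE ?addr_ge0 ?sqrtC_ge0 ?dnorm_ge0//.
rewrite sqrtCK sqrrD !sqrtCK dnormD [leRHS]addrAC lerD2l.
have -> : d u v + ((d u v)^*) = 2%:R * 'Re (d u v).
  by rewrite ReE mulrC divfK// pnatr_eq0.
rewrite -[leRHS]mulr_natl ler_pM2l ?ltr0n//.
have := dot_CauchySchwarz u v.
rewrite -{1}(sqrtCK (d u u)) -{1}(sqrtCK (d v v)) -exprMn.
rewrite ler_pXn2r ?nnegrE ?mulr_ge0 ?sqrtC_ge0//.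
by apply: le_trans; rewrite leif_Re_Creal.
Qed.
End DotNorm.

Record closed_subspace (R : realType) (H : hilbertType R) := ClosedSubspace {
  csub_set :> set H ;
  csub0 : csub_set 0 ;
  csubP : forall (a : R[i]) x y,
    csub_set x -> csub_set y -> csub_set (a *: x + y) ;
  csub_closed : closed csub_set
}.

Record subspace (R : realType) (H : hilbertType R) (S : closed_subspace H) :=
  SubVec { subval : H ; subval_in : subval \in (S : set H) }.

Section Subspace.
Variables (R : realType) (H : hilbertType R) (S : closed_subspace H).

HB.instance Definition _ := [isSub for @subval R H S].
HB.instance Definition _ := [Choice of subspace S by <:].

Let subspace_closed : submod_closed (fun x : H => x \in (S : set H)).
Proof.
split; first by rewrite unfold_in; apply/mem_set/csub0.
move=> a x y; rewrite !unfold_in => /set_mem Sx /set_mem Sy.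
exact/mem_set/csubP.
Qed.

HB.instance Definition _ :=
  GRing.SubChoice_isSubLmodule.Build R[i] H _ (subspace S) subspace_closed.

Let sub_norm (x : subspace S) : R[i] := `|val x|.

Let sub_normD x y : sub_norm (x + y) <= sub_norm x + sub_norm y.
Proof. by rewrite /sub_norm raddfD ler_normD. Qed.

Let sub_normZ (l : R[i]) x : sub_norm (l *: x) = `|l| * sub_norm x.
Proof. by rewrite /sub_norm linearZ /= normrZ. Qed.

Let sub_norm0 x : sub_norm x = 0 -> x = 0.
Proof. by move/eqP; rewrite normr_eq0 => /eqP x0; apply/val_inj; rewrite raddf0. Qed.

HB.instance Definition _ :=
  Lmodule_isNormed.Build R[i] (subspace S) sub_normD sub_normZ sub_norm0.

Lemma subval_norm (x : subspace S) : `|x| = `|val x|.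
Proof. by []. Qed.

Let subspace_complete (F : set_system (subspace S)) :
  ProperFilter F -> cauchy F -> cvg F.
Proof.
move=> FF /cauchy_ballP Fc.
pose G := (fun x => val x) @ F.
have GF : ProperFilter G by exact: fmap_proper_filter.
have : cauchy G.
  apply/cauchy_ballP => e e0.
  have Fe := Fc e e0.
  rewrite near_map2; apply: filterS Fe => -[x y]; rewrite -!ball_normE /=.
  by rewrite subval_norm raddfB.
move=> /cauchy_cvg /cvg_ex [l Gl].
have Sl : l \in (S : set H).
  have SF : \forall x \near F, (S : set H) (val x).
    by apply: nearW => x; apply/set_mem/subval_in.
  apply/mem_set.
  exact: (@closed_cvg _ _ F FF val (csub_set S) (@csub_closed _ _ S) SF l Gl).
apply/cvg_ex; exists (SubVec Sl).
apply/cvgrPdist_lt => e e0.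
by move/cvgrPdist_lt : Gl => /(_ e e0).
Qed.

HB.instance Definition _ :=
  Uniform_isComplete.Build (subspace S) subspace_complete.

Definition sub_dot (x y : subspace S) : R[i] := hdot (val x) (val y).

Lemma subvalP (a : R[i]) (x y : subspace S) :
  val (a *: x + y) = a *: val x + val y.
Proof. exact: linearP. Qed.

Let sub_dot_bilinear :
  bilinear_for (@GRing.mul R[i]) (Num.conj \; *%R) sub_dot.
Proof.
split=> [y a x x'|x a y y'] /=; rewrite /sub_dot subvalP.
  by rewrite linearPl.
by rewrite linearPr.
Qed.

HB.instance Definition _ :=
  bilinear_isBilinear.Build R[i] _ _ _ _ _ sub_dot sub_dot_bilinear.

Let sub_dot_herm x y : sub_dot x y = (-1) ^+ false * (sub_dot y x)^*.
Proof. exact: hermitian_subproof. Qed.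

HB.instance Definition _ :=
  isHermitianSesquilinear.Build R[i] _ _ _ sub_dot sub_dot_herm.

Let sub_dot_gt0 x : x != 0 -> 0 < sub_dot x x.
Proof.
by move=> x0; apply: neq0_dnorm_gt0; apply: contra x0 => /eqP x0;
  apply/eqP/val_inj; rewrite x0 raddf0.
Qed.

HB.instance Definition _ :=
  isDotProduct.Build R[i] _ sub_dot sub_dot_gt0.

Let sub_dot_norm (x : subspace S) :
  (sub_dot : {dot (subspace S) for Num.conj}) x x = `|x| ^+ 2.
Proof. exact: hdot_norm. Qed.

HB.instance Definition _ :=
  NormedModule_isHilbert.Build R (subspace S) sub_dot_norm.

End Subspace.

(* [H * K] already carries the maximum norm, hence the alias. *)
Definition hsum (R : realType) (H K : hilbertType R) : Type := (H * K)%type.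

Section HilbertSum.
Variables (R : realType) (H K : hilbertType R).

HB.instance Definition _ := GRing.Lmodule.copy (hsum H K) (H * K)%type.

Definition hsum_dot (x y : hsum H K) : R[i] := hdot x.1 y.1 + hdot x.2 y.2.

Let hsum_dot_bilinear :
  bilinear_for (@GRing.mul R[i]) (Num.conj \; *%R) hsum_dot.
Proof.
split=> [y a x x'|x a y y'] /=; rewrite /hsum_dot /=.
  by rewrite !linearPl mulrDr addrACA.
by rewrite !linearPr /= mulrDr addrACA.
Qed.

HB.instance Definition _ :=
  bilinear_isBilinear.Build R[i] _ _ _ _ _ hsum_dot hsum_dot_bilinear.

Let hsum_dot_herm x y : hsum_dot x y = (-1) ^+ false * (hsum_dot y x)^*.
Proof.
rewrite /hsum_dot rmorphD mulrDr.
by rewrite [in LHS]hermitian_subproof [hdot x.2 _]hermitian_subproof.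
Qed.

HB.instance Definition _ :=
  isHermitianSesquilinear.Build R[i] _ _ _ hsum_dot hsum_dot_herm.

Let hsum_dot_gt0 x : x != 0 -> 0 < hsum_dot x x.
Proof.
move=> x0; rewrite lt_def addr_ge0 ?dnorm_ge0// andbT.
apply: contra x0; rewrite paddr_eq0 ?dnorm_ge0// !dnorm_eq0.
by move=> /andP[/eqP x1 /eqP x2]; apply/eqP; case: x x1 x2 => a b /= -> ->.
Qed.

HB.instance Definition _ :=
  isDotProduct.Build R[i] _ hsum_dot hsum_dot_gt0.

Let hsum_norm (x : hsum H K) : R[i] := sqrtC (hsum_dot x x).

Let hsum_normD x y : hsum_norm (x + y) <= hsum_norm x + hsum_norm y.
Proof. exact: dot_normD. Qed.

Let hsum_normZ (l : R[i]) x : hsum_norm (l *: x) = `|l| * hsum_norm x.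
Proof.
by rewrite /hsum_norm dnormZ sqrtCM ?nnegrE ?exprn_ge0 ?dnorm_ge0// sqrCK.
Qed.

Let hsum_norm0 x : hsum_norm x = 0 -> x = 0.
Proof. by move/eqP; rewrite sqrtC_eq0 dnorm_eq0 => /eqP. Qed.

HB.instance Definition _ :=
  Lmodule_isNormed.Build R[i] (hsum H K) hsum_normD hsum_normZ hsum_norm0.

Lemma hsum_normE (x : hsum H K) : `|x| ^+ 2 = `|x.1| ^+ 2 + `|x.2| ^+ 2.
Proof. by rewrite sqrtCK /hsum_dot !hdot_norm. Qed.

Lemma hsum_norm1_le (x : hsum H K) : `|x.1| <= `|x|.
Proof.
by rewrite -(@ler_pXn2r _ 2%N) ?nnegrE// hsum_normE lerDl exprn_ge0.
Qed.

Lemma hsum_norm2_le (x : hsum H K) : `|x.2| <= `|x|.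
Proof.
by rewrite -(@ler_pXn2r _ 2%N) ?nnegrE// hsum_normE lerDr exprn_ge0.
Qed.

Lemma hsum_norm_leD (x : hsum H K) : `|x| <= `|x.1| + `|x.2|.
Proof.
rewrite -(@ler_pXn2r _ 2%N) ?nnegrE ?addr_ge0// hsum_normE sqrrD.
by rewrite -addrA lerD2l lerDr mulrn_wge0 ?mulr_ge0.
Qed.

Let hsum_complete (F : set_system (hsum H K)) :
  ProperFilter F -> cauchy F -> cvg F.
Proof.
move=> FF /cauchy_ballP Fc.
have c1 : cauchy ((fun x : hsum H K => x.1) @ F).
  apply/cauchy_ballP => e e0; have Fe := Fc e e0.
  rewrite near_map2; apply: filterS Fe => -[x y]; rewrite -!ball_normE /=.
  exact/le_lt_trans/(hsum_norm1_le (x - y)).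
have c2 : cauchy ((fun x : hsum H K => x.2) @ F).
  apply/cauchy_ballP => e e0; have Fe := Fc e e0.
  rewrite near_map2; apply: filterS Fe => -[x y]; rewrite -!ball_normE /=.
  exact/le_lt_trans/(hsum_norm2_le (x - y)).
have [l1 /cvgrPdist_lt F1] := (cvg_ex _).1 (cauchy_cvg _ c1).
have [l2 /cvgrPdist_lt F2] := (cvg_ex _).1 (cauchy_cvg _ c2).
apply/cvg_ex; exists ((l1, l2) : hsum H K).
apply/(@cvgrPdist_lt _ (hsum H K)) => e e0; have e20 : 0 < e / 2%:R by rewrite divr_gt0.
near=> x.
apply: le_lt_trans (hsum_norm_leD _) _; rewrite [e]splitr ltrD//=.
  by near: x; exact: F1.
by near: x; exact: F2.
Unshelve. all: by end_near. Qed.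

HB.instance Definition _ :=
  Uniform_isComplete.Build (hsum H K) hsum_complete.

Let hsum_dot_norm (x : hsum H K) :
  (hsum_dot : {dot (hsum H K) for Num.conj}) x x = `|x| ^+ 2.
Proof. by rewrite sqrtCK. Qed.

HB.instance Definition _ :=
  NormedModule_isHilbert.Build R (hsum H K) hsum_dot_norm.

Definition hsum_fst : set (hsum H K) := [set x | x.2 = 0].

Let hsum_fst0 : hsum_fst 0. Proof. by []. Qed.

Let hsum_fstP (a : R[i]) x y :
  hsum_fst x -> hsum_fst y -> hsum_fst (a *: x + y).
Proof. by rewrite /hsum_fst /= => -> ->; rewrite scaler0 addr0. Qed.

Let hsum_fst_closed : closed hsum_fst.
Proof.
move=> x clx; apply/eqP; apply: contrapT => /negP x2.
have /clx[z [z2]] : nbhs x (ball x `|x.2|).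
  by apply: nbhsx_ballx; rewrite normr_gt0.
rewrite -ball_normE /= => /(le_lt_trans (hsum_norm2_le _)) /=.
by rewrite z2 subr0 ltxx.
Qed.

(* The subspace [H (+) {0}] of [H (+) K]. *)
Definition hsum_left : closed_subspace (hsum H K) :=
  ClosedSubspace hsum_fst0 hsum_fstP hsum_fst_closed.

End HilbertSum.
Arguments hsum_left {R} H K.

Section Orthogonal.
Variables (R : realType) (H : hilbertType R).

Definition orthoset (X : set H) : set H :=
  [set x | forall y, X y -> hdot x y = 0].

Variable X : set H.

Let orthoset0 : orthoset X 0.
Proof. by move=> y _; rewrite linear0l. Qed.

Let orthosetP (a : R[i]) x y :
  orthoset X x -> orthoset X y -> orthoset X (a *: x + y).
Proof.
by move=> ox oy z Xz; rewrite linearPl /= ox// oy// mulr0 addr0.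
Qed.

Let orthoset_closed : closed (orthoset X).
Proof.
move=> x clx y Xy; apply/eqP; apply: contrapT => /negP xy0.
have y0 : 0 < `|y|.
  by rewrite normr_gt0; apply: contraNneq xy0 => ->; rewrite linear0r.
have /clx[z [oz]] : nbhs x (ball x (`|hdot x y| / `|y|)).
  by apply: nbhsx_ballx; rewrite divr_gt0// normr_gt0.
rewrite -ball_normE /= ltr_pdivlMr// => xzy.
have := dot_CauchySchwarz hdot (x - z) y.
rewrite linearBl /= oz// subr0 !hdot_norm -exprMn.
rewrite ler_pXn2r ?nnegrE ?mulr_ge0// => /(lt_le_trans xzy).
by rewrite ltxx.
Qed.

Definition ortho_csub : closed_subspace H :=
  ClosedSubspace orthoset0 orthosetP orthoset_closed.

End Orthogonal.

Record bounded_op (R : realType) (H K : hilbertType R) := BoundedOp {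
  bop_fun :> H -> K ;
  bop_linear : linear bop_fun ;
  bop_bounded : exists M : R[i], forall x, `|bop_fun x| <= M * `|x|
}.

Section BoundedOpTheory.
Variables (R : realType).
Implicit Types H K : hilbertType R.

HB.instance Definition _ H K (A : bounded_op H K) :=
  GRing.isLinear.Build R[i] H K *:%R A (bop_linear A).

Lemma bopP H K (A B : bounded_op H K) : (A : H -> K) =1 B -> A = B.
Proof.
case: A B => [f lf bf] [g lg bg] /= /funext fg; move: lf bf; rewrite fg => lf bf.
by rewrite (Prop_irrelevance lf lg) (Prop_irrelevance bf bg).
Qed.

HB.instance Definition _ H K := gen_eqMixin (bounded_op H K).
HB.instance Definition _ H K := gen_choiceMixin (bounded_op H K).

Lemma bop_bound H K (A : bounded_op H K) :
  exists2 M : R[i], 0 <= M & forall x, `|A x| <= M * `|x|.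
Proof.
have [M AM] := bop_bounded A; exists `|M| => // x.
by rewrite -(normr_id x) -normrM ger0_norm// (le_trans _ (AM x)).
Qed.


Section Operations.
Variables H K : hilbertType R.
Implicit Types A B : bounded_op H K.

Let zero_linear : linear (fun _ : H => 0 : K).
Proof. by move=> a x y; rewrite scaler0 addr0. Qed.

Let zero_bounded :
  exists M : R[i], forall x : H, `|(fun _ : H => 0 : K) x| <= M * `|x|.
Proof. by exists 0 => x; rewrite normr0 mul0r. Qed.

Definition bop0 := BoundedOp zero_linear zero_bounded.

Let opp_linear A : linear (fun x => - A x).
Proof. by move=> a x y; rewrite linearP opprD scalerN. Qed.

Let opp_bounded A : exists M : R[i], forall x, `|- A x| <= M * `|x|.
Proof. by have [M AM] := bop_bounded A; exists M => x; rewrite normrN. Qed.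

Definition bop_opp A := BoundedOp (opp_linear A) (opp_bounded A).

Let add_linear A B : linear (fun x => A x + B x).
Proof. by move=> a x y; rewrite !linearP scalerDr addrACA. Qed.

Let add_bounded A B : exists M : R[i], forall x, `|A x + B x| <= M * `|x|.
Proof.
have [M AM] := bop_bounded A; have [N BN] := bop_bounded B.
exists (M + N) => x.
by rewrite (le_trans (ler_normD _ _))// mulrDl lerD.
Qed.

Definition bop_add A B := BoundedOp (add_linear A B) (add_bounded A B).

Let bop_addA : associative bop_add.
Proof. by move=> A B C; apply: bopP => x /=; rewrite addrA. Qed.

Let bop_addC : commutative bop_add.
Proof. by move=> A B; apply: bopP => x /=; rewrite addrC. Qed.

Let bop_add0 : left_id bop0 bop_add.
Proof. by move=> A; apply: bopP => x /=; rewrite add0r. Qed.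

Let bop_addN : left_inverse bop0 bop_opp bop_add.
Proof. by move=> A; apply: bopP => x /=; rewrite addNr. Qed.

HB.instance Definition _ := GRing.isZmodule.Build (bounded_op H K)
  bop_addA bop_addC bop_add0 bop_addN.

End Operations.

Section Composition.
Variables (H K L : hilbertType R) (A : bounded_op K L) (B : bounded_op H K).

Let comp_linear : linear (fun x => A (B x)).
Proof. by move=> a x y; rewrite !linearP. Qed.

Let comp_bounded : exists M : R[i], forall x, `|A (B x)| <= M * `|x|.
Proof.
have [M M0 AM] := bop_bound A; have [N _ BN] := bop_bound B.
by exists (M * N) => x; rewrite (le_trans (AM _))// -mulrA ler_wpM2l.
Qed.

Definition bop_comp := BoundedOp comp_linear comp_bounded.

End Composition.

Section Inclusion.
Variables (H : hilbertType R) (S : closed_subspace H).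

Let incl_bounded :
  exists M : R[i], forall x : subspace S, `|val x : H| <= M * `|x|.
Proof. by exists 1 => x; rewrite mul1r subval_norm. Qed.

Definition incl : bounded_op (subspace S) H :=
  BoundedOp (@subvalP R H S) incl_bounded.

End Inclusion.

Section OperatorMatrix.
Variables H1 H2 K1 K2 : hilbertType R.
Variables (A11 : bounded_op H1 K1) (A12 : bounded_op H2 K1).
Variables (A21 : bounded_op H1 K2) (A22 : bounded_op H2 K2).

Let opmx_fun (x : hsum H1 H2) : hsum K1 K2 :=
  (A11 x.1 + A12 x.2, A21 x.1 + A22 x.2).

Let opmx_linear : linear opmx_fun.
Proof.
move=> a x y; rewrite /opmx_fun /= !linearP /=.
by congr (_, _); rewrite /= scalerDr addrACA.
Qed.

Let opmx_bounded : exists M : R[i], forall x, `|opmx_fun x| <= M * `|x|.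
Proof.
have [a a0 A11a] := bop_bound A11; have [b b0 A12b] := bop_bound A12.
have [c c0 A21c] := bop_bound A21; have [d d0 A22d] := bop_bound A22.
exists (a + b + (c + d)) => x.
rewrite (le_trans (hsum_norm_leD _))//= mulrDl.
apply: lerD; apply: le_trans (ler_normD _ _) _; rewrite mulrDl; apply: lerD.
- by apply: le_trans (A11a _) _; rewrite ler_wpM2l// hsum_norm1_le.
- by apply: le_trans (A12b _) _; rewrite ler_wpM2l// hsum_norm2_le.
- by apply: le_trans (A21c _) _; rewrite ler_wpM2l// hsum_norm1_le.
- by apply: le_trans (A22d _) _; rewrite ler_wpM2l// hsum_norm2_le.
Qed.

Definition opmx : bounded_op (hsum H1 H2) (hsum K1 K2) :=
  BoundedOp opmx_linear opmx_bounded.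

End OperatorMatrix.

End BoundedOpTheory.

Notation "A ** B" := (bop_comp A B) (at level 40, left associativity)
  : ring_scope.

Definition kernel (R : realType) (H K : hilbertType R) (A : bounded_op H K) :
  set H := [set x | A x = 0].

(* [adj], [proj], [sqrt_op], [polar], [reduced], [parallel_sum] and
   [parallel_sub] denote the unique operator with the stated property; [xget]
   selects it, and returns the default [0] when there is none. *)

Section OperatorTheory.
Variable R : realType.
Implicit Types H K L : hilbertType R.

Definition adj H K (A : bounded_op H K) : bounded_op K H :=
  xget 0 [set B : bounded_op K H | forall x y, hdot (A x) y = hdot x (B y)].

(* The orthogonal projection onto [S], corestricted to [S]. *)
Definition proj H (S : closed_subspace H) : bounded_op H (subspace S) :=
  xget 0 [set P : bounded_op H (subspace S) |
    forall x (y : subspace S), hdot (x - val (P x)) (val y) = 0].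

Definition positive_op H (A : bounded_op H H) : Prop :=
  forall x, 0 <= hdot (A x) x.

Definition sqrt_op H (A : bounded_op H H) : bounded_op H H :=
  xget 0 [set B : bounded_op H H | positive_op B /\ B ** B = A].

Definition abs_op H K (A : bounded_op H K) : bounded_op H H :=
  sqrt_op (adj A ** A).

Definition partial_isometry H K (U : bounded_op H K) : Prop :=
  forall x, orthoset (kernel U) x -> `|U x| = `|x|.

Definition polar H K (A : bounded_op H K) : bounded_op H K :=
  xget 0 [set U : bounded_op H K |
    [/\ partial_isometry U, kernel U = kernel A & A = U ** abs_op A]].

Definition reduced H K L (X : bounded_op K L) (Y : bounded_op H L) :
    bounded_op H K :=
  xget 0 [set D : bounded_op H K |
    X ** D = Y /\ range D `<=` orthoset (kernel X)].

End OperatorTheory.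

Section Shorted.
Variables (R : realType) (H1 H2 : hilbertType R).
Variables (S : closed_subspace H1) (T : closed_subspace H2).
Implicit Types A : bounded_op H1 H2.

Local Notation S' := (ortho_csub S).
Local Notation T' := (ortho_csub T).

Definition block11 A : bounded_op (subspace S) (subspace T) :=
  proj T ** A ** incl S.
Definition block12 A : bounded_op (subspace S') (subspace T) :=
  proj T ** A ** incl S'.
Definition block21 A : bounded_op (subspace S) (subspace T') :=
  proj T' ** A ** incl S.
Definition block22 A : bounded_op (subspace S') (subspace T') :=
  proj T' ** A ** incl S'.

Definition complementable A : Prop :=
  range (block21 A) `<=` range (block22 A) /\
  range (adj (block12 A)) `<=` range (adj (block22 A)).

Definition weakly_complementable A : Prop :=
  range (block21 A) `<=` range (sqrt_op (abs_op (adj (block22 A)))) /\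
  range (adj (block12 A)) `<=` range (sqrt_op (abs_op (block22 A))).

(* Only meaningful when [weakly_complementable A], which is what makes the two
   reduced solutions exist. *)
Definition shorted A : bounded_op H1 H2 :=
  let A22 := block22 A in
  let E : bounded_op (subspace S) (subspace S') :=
    reduced (sqrt_op (abs_op (adj A22)) ** polar A22) (block21 A) in
  let F : bounded_op (subspace T) (subspace S') :=
    reduced (sqrt_op (abs_op A22)) (adj (block12 A)) in
  incl T ** (block11 A - adj F ** E) ** proj S.

End Shorted.

Section Parallel.
Variables (R : realType) (H1 H2 : hilbertType R).
Implicit Types A B C X : bounded_op H1 H2.

Definition parallel_summable A B : Prop :=
  range A `<=` range (A + B) /\ range (adj A) `<=` range (adj A + adj B).

(* Only meaningful when [A] and [B] are parallel summable. *)
Definition parallel_sum A B : bounded_op H1 H2 :=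
  xget 0 [set P : bounded_op H1 H2 |
    opmx P 0 0 0 =
      shorted (hsum_left H1 H1) (hsum_left H2 H2) (opmx A A A (A + B))].

(* $\mathcal{D}_A$ *)
Definition sub_class A : set (bounded_op H1 H2) :=
  [set C | range (C - A) = range A /\ range (adj (C - A)) = range (adj A)].

(* Only meaningful when [C] belongs to [sub_class A]. *)
Definition parallel_sub C A : bounded_op H1 H2 :=
  xget 0 [set X : bounded_op H1 H2 |
    [/\ parallel_summable A X, parallel_sum A X = C,
        range (A + X) = range A & range (adj (A + X)) = range (adj A)]].

End Parallel.

(* Main.v *)
Require Import Defs.
From HB Require Import structures.
From mathcomp Require Import all_boot all_order all_algebra.
From mathcomp Require Import complex.
From mathcomp Require Import boolp classical_sets functions reals.
From mathcomp Require Import topology normedtype.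
From mathcomp Require Import ring lra.

Import Order.TTheory GRing.Theory Num.Theory.
Import numFieldNormedType.Exports.

Local Open Scope classical_set_scope.
Local Open Scope ring_scope.

Set Implicit Arguments.
Unset Strict Implicit.
Unset Printing Implicit Defensive.

(* Shadowed by classical_sets and topology. *)
Local Notation incl := Defs.incl.
Local Notation proj := Defs.proj.
Local Notation subspace := Defs.subspace.

(* A (S,T)-complementable A factors through its Schur complement X = A_/(S,T): with
   A21 = A22 Z and A12 = W A22 one has A = (1 + w) (X + A22) (1 + z), where z and w are
   Z and W extended by 0. Since L is an isomorphism of S onto T (extended by 0), a
   Neumann series inverts D = X + nL from S onto T for n large; call K this inverse.
   The factorisation then gives A : nL = X - X K X, which, as X = D - nL, equals
   nL - nL K nL = nL : X. For any Y such that nL + Y has range T and adjoint range S,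
   nL : Y = nL - nL K' nL with K' the inverse of nL + Y, so nL : Y = nL : X forces
   K' = K and Y = X.

   The shorted operator is defined through square roots and a polar decomposition, so
   these are constructed too: the square root of A as 1 - lim Y_n, where
   Y_(n+1) = (1 - A + Y_n^2) / 2, and reduced solutions from uniform boundedness. *)

(** * Real-valued norm and projections *)

(** The sum A + nL need not be invertible between closed subspaces, since the range of A22 need not
    be closed. Only the corner X + nL is inverted. As nL vanishes on the range of z and w vanishes
    on that of nL, the outer factors of A leave nL unchanged, so this corner controls the whole
    parallel sum. Complementability provides bounded Z and W, and with them the roots and the polar
    factor cancel from the shorted operator, which becomes A11 - W A22 Z. The cancellation still
    presupposes that these objects exist: adjoints, projections, roots, polar factors, reduced
    solutions, parallel sums and parallel substractions are all choices by [xget], with the value 0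
    if there is no witness. A witness gives the defining property of the chosen operator; a
    uniqueness argument then identifies it. Limits are taken with explicit error bounds dominated by
    c / (n + 1), so that most convergence arguments become inequalities in R. *)

Section RealNorm.
Variables (R : realType) (H : hilbertType R).
Implicit Types (x y z : H) (a : R[i]).

Lemma le_inv_nat_le0 (c x : R) : (forall n : nat, x <= c / n.+1%:R) -> x <= 0.
Proof.
move=> xc; rewrite leNgt; apply/negP => x0.
pose n := Num.Def.archi_bound (c / x).
have := xc n.
have [c0|c0] := leP c 0.
  move/(lt_le_trans x0); rewrite ltNge => /negP; apply.
  by rewrite mulr_le0_ge0// invr_ge0.
rewrite ler_pdivlMr// => h.
have : c / x < n%:R by apply: archi_boundP; rewrite divr_ge0// ltW.
rewrite ltr_pdivrMr// => h2.
move: h; rewrite -natr1 mulrDr mulr1 mulrC; lra.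
Qed.

(** Norms take values in R[i], whose order is only partial; their real parts lie in R, where [lra]
    and [nra] apply. *)
Definition nrm x : R := complex.Re `|x|.
Definition rdot x y : R := complex.Re (hdot x y).

Lemma nrmE x : (nrm x)%:C%C = `|x|.
Proof. by rewrite /nrm RRe_real// normr_real. Qed.

Lemma nrm_ge0 x : 0 <= nrm x.
Proof. by rewrite -ler0c nrmE. Qed.

Lemma nrmD x y : nrm (x + y) <= nrm x + nrm y.
Proof. by rewrite -lecR rmorphD /= !nrmE ler_normD. Qed.

Lemma nrmZ a x : nrm (a *: x) = complex.Re `|a| * nrm x.
Proof.
apply: complexI; rewrite rmorphM /= !nrmE normrZ; congr (_ * _).
Qed.

Lemma nrmN x : nrm (- x) = nrm x.
Proof. by rewrite /nrm normrN. Qed.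

Lemma nrm_eq0 x : nrm x = 0 -> x = 0.
Proof. by move=> n0; apply/eqP; rewrite -normr_eq0 -nrmE n0. Qed.

Lemma nrm_subC x y : nrm (x - y) = nrm (y - x).
Proof. by rewrite -nrmN opprB. Qed.

Lemma nrm0 : nrm (0 : H) = 0.
Proof. by rewrite /nrm normr0. Qed.

Lemma hdotDl x y z : hdot (x + y) z = hdot x z + hdot y z.
Proof. exact: linearDl. Qed.
Lemma hdotDr x y z : hdot z (x + y) = hdot z x + hdot z y.
Proof. exact: linearDr. Qed.
Lemma hdotNl x z : hdot (- x) z = - hdot x z.
Proof. exact: linearNl. Qed.
Lemma hdotNr x z : hdot z (- x) = - hdot z x.
Proof. exact: linearNr. Qed.
Lemma hdotZl a x z : hdot (a *: x) z = a * hdot x z.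
Proof. exact: linearZl_LR. Qed.
Lemma hdotZr a x z : hdot z (a *: x) = a^*%R * hdot z x.
Proof. exact: linearZr_LR. Qed.
Lemma hdot0l z : hdot 0 z = 0 :> R[i].
Proof. exact: linear0l. Qed.
Lemma hdot0r z : hdot z 0 = 0 :> R[i].
Proof. exact: linear0r. Qed.
Lemma hdotC x y : hdot x y = (hdot y x)^*%R.
Proof. by rewrite [LHS]hermitian_subproof expr0 mul1r. Qed.
Lemma hdotBl x y z : hdot (x - y) z = hdot x z - hdot y z.
Proof. by rewrite hdotDl hdotNl. Qed.
Lemma hdotxx x : hdot x x = (nrm x ^+ 2)%:C%C.
Proof. by rewrite rmorphXn /= nrmE hdot_norm. Qed.

Lemma hdot_eq0 x : hdot x x = 0 -> x = 0.
Proof.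
rewrite hdotxx => /complexI/eqP; rewrite sqrf_eq0 => /eqP; exact: nrm_eq0.
Qed.

Lemma hdot_ext x y : (forall z, hdot x z = hdot y z) -> x = y.
Proof.
move=> h; apply/eqP; rewrite -subr_eq0; apply/eqP/hdot_eq0.
by rewrite hdotBl h subrr.
Qed.

Lemma hdot_sym0 x y : hdot x y = 0 -> hdot y x = 0.
Proof. by rewrite (hdotC y) => ->; rewrite rmorph0. Qed.

Lemma rdotDl x y z : rdot (x + y) z = rdot x z + rdot y z.
Proof. by rewrite /rdot hdotDl raddfD. Qed.
Lemma rdotNl x z : rdot (- x) z = - rdot x z.
Proof. by rewrite /rdot hdotNl raddfN. Qed.
Lemma rdotBl x y z : rdot (x - y) z = rdot x z - rdot y z.
Proof. by rewrite rdotDl rdotNl. Qed.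
Lemma rdotC x y : rdot x y = rdot y x.
Proof. by rewrite /rdot hdotC; case: (hdot y x). Qed.
Lemma rdotBr x y z : rdot z (x - y) = rdot z x - rdot z y.
Proof. by rewrite !(rdotC z) rdotBl. Qed.
Lemma rdotZl (t : R) x z : rdot (t%:C%C *: x) z = t * rdot x z.
Proof.
by rewrite /rdot hdotZl; case: (hdot x z) => u v; simpc.
Qed.
Lemma rdotxx x : rdot x x = nrm x ^+ 2.
Proof. by rewrite /rdot hdotxx. Qed.

Lemma nrm_sqrB (t : R) x y :
  nrm (x - t%:C%C *: y) ^+ 2 =
  nrm x ^+ 2 - 2 * t * rdot x y + t ^+ 2 * nrm y ^+ 2.
Proof.
rewrite -!rdotxx rdotBl !rdotBr !rdotZl (rdotC x (_ *: _)) (rdotC y (_ *: _)).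
rewrite !rdotZl (rdotC y x); ring.
Qed.

Lemma CauchySchwarz x y : complex.Re `|hdot x y| <= nrm x * nrm y.
Proof.
have := dot_CauchySchwarz hdot x y; rewrite !hdot_norm -exprMn.
rewrite ler_pXn2r ?nnegrE ?mulr_ge0//.
by rewrite -!nrmE -rmorphM /= lecE => /andP[].
Qed.

Lemma rdot_le x y : `|rdot x y| <= nrm x * nrm y.
Proof.
apply: le_trans (CauchySchwarz x y).
by rewrite -lecR RRe_real ?normr_real//; apply: normc_ge_Re.
Qed.

(** The rate c / (m + 1) only ensures convergence. The finer bound r m survives in the limit, as
    needed when r m is the radius of a closed ball that must contain l. *)
Lemma cauchy_lim (c : R) (r : nat -> R) (u : nat -> H) :
  (forall m, r m <= c / m.+1%:R) ->
  (forall m n, (m <= n)%N -> nrm (u n - u m) <= r m) ->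
  exists l, forall m, nrm (l - u m) <= r m.
Proof.
move=> rc ur.
have uc m n : (m <= n)%N -> nrm (u n - u m) <= c / m.+1%:R.
  by move=> mn; apply: le_trans (ur _ _ mn) (rc m).
have c0 : 0 <= c.
  by have := uc 0 0 isT; rewrite subrr nrm0 divr1.
have near_c (e : R[i]) : 0 < e -> exists N : nat, forall n, (N <= n)%N ->
    (c / n.+1%:R)%:C%C < e.
  move=> e0.
  have eR : e = (complex.Re e)%:C%C by rewrite RRe_real// gtr0_real.
  have e0' : 0 < complex.Re e by rewrite -ltcR -eR.
  exists (Num.Def.archi_bound (c / complex.Re e)) => n Nn.
  rewrite eR ltcR ltr_pdivrMr// mulrC -ltr_pdivrMr//.
  apply: lt_le_trans (archi_boundP _) _; first by rewrite divr_ge0// ltW.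
  by rewrite ler_nat ltnW.
have /cauchy_cvg/cvg_ex[l ul] : cauchy (u @ \oo).
  apply/cauchy_ballP => e e0.
  have [N NP] := near_c _ e0.
  rewrite near_map2.
  exists ([set n | (N <= n)%N], [set n | (N <= n)%N]).
    by split; exists N.
  move=> [m n] /= [Nm Nn]; rewrite -ball_normE /= -nrmE.
  have [mn|nm] := leqP m n.
    by apply: le_lt_trans (NP m Nm); rewrite lecR nrm_subC uc.
  by apply: le_lt_trans (NP n Nn); rewrite lecR uc// ltnW.
exists l => m; rewrite -subr_le0.
apply: (@le_inv_nat_le0 1) => k.
have k0 : 0 < (k.+1%:R^-1)%:C%C :> R[i] by rewrite ltcR invr_gt0 ltr0n.
move/cvgrPdist_lt : ul => /(_ _ k0) [N _ NP].
have := NP (maxn N m) (leq_maxl _ _); rewrite /= -nrmE ltcR => h1.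
have := ur m (maxn N m) (leq_maxr _ _) => h2.
have := nrmD (l - u (maxn N m)) (u (maxn N m) - u m); rewrite addrA subrK.
rewrite div1r; move: h1 h2; set i := k.+1%:R^-1; lra.
Qed.

Lemma closed_approx (S : closed_subspace H) (l : H) (c : R) :
  (forall n : nat, exists2 s, (S : set H) s & nrm (l - s) <= c / n.+1%:R) ->
  (S : set H) l.
Proof.
move=> lc; apply: (@csub_closed _ _ S) => B /nbhs_ballP[e /= e0 eB].
have eR : e = (complex.Re e)%:C%C by rewrite RRe_real// gtr0_real.
have e0' : 0 < complex.Re e by rewrite -ltcR -eR.
have [n nP] : exists n : nat, c / n.+1%:R < complex.Re e.
  apply/not_existsP => h; suff : complex.Re e <= 0 by rewrite leNgt e0'.
  by apply: (@le_inv_nat_le0 c) => n; rewrite leNgt; apply/negP/h.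
have [s Ss ls] := lc n; exists s; split => //.
apply: eB; rewrite -ball_normE /= -nrmE eR ltcR; exact: le_lt_trans nP.
Qed.

End RealNorm.

Section Projection.
Variables (R : realType) (H : hilbertType R).
Implicit Types (x y z : H) (a : R[i]).

(** V need not be closed, so l is only a limit of points of V. This covers kernels of functionals
    and ranges of adjoints as well as closed subspaces. *)
Lemma nearest_point (V : set H) (d : H) :
  V 0 -> (forall a x y, V x -> V y -> V (a *: x + y)) ->
  exists l, (forall n : nat, exists2 v, V v & nrm (l - v) <= 2 / n.+1%:R)
         /\ forall v, V v -> hdot (d - l) v = 0.
Proof.
move=> V0 VP.
have VZ a x : V x -> V (a *: x) by move=> Vx; rewrite -[_ *: _]addr0; apply: VP.
have VB x y : V x -> V y -> V (x - y).
  by move=> Vx Vy; rewrite addrC -scaleN1r; apply: VP.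
pose E := [set r : R | exists2 v, V v & r = nrm (d - v) ^+ 2].
have infE : has_inf E.
  split; first by exists (nrm (d - 0) ^+ 2), 0.
  by exists 0 => _ [v _ ->]; rewrite exprn_ge0// nrm_ge0.
have ex n : exists v, V v /\ nrm (d - v) ^+ 2 < inf E + n.+1%:R^-1 ^+ 2.
  have e0 : 0 < (n.+1%:R^-1 : R) ^+ 2 by rewrite exprn_gt0// invr_gt0 ltr0n.
  by have [_ [v Vv ->] lt] := inf_adherent e0 infE; exists v.
have [u uP] := choice ex.
have Vu n : V (u n) by have [] := uP n.
(* Moving from u n along v by the optimal step t lowers the squared distance by the square of the
   inner product over the squared norm of v; this gain is at most the excess 1 / (n + 1)^2 over the
   infimum. *)
have orth n v : V v -> `|rdot (d - u n) v| <= nrm v / n.+1%:R.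
  move=> Vv; have [->|v0] := eqVneq v 0.
    by rewrite /rdot hdot0r nrm0 mul0r normr0.
  have nv : 0 < nrm v.
    by rewrite lt_def nrm_ge0 andbT; apply: contra v0 => /eqP/nrm_eq0 ->.
  rewrite -(@ler_pXn2r _ 2%N) ?nnegrE ?divr_ge0 ?(ltW nv)//.
  rewrite real_normK ?num_real//.
  pose t := rdot (d - u n) v / nrm v ^+ 2.
  have : inf E <= nrm (d - u n - t%:C%C *: v) ^+ 2.
    apply: ge_inf; first by case: infE.
    exists (t%:C%C *: v + u n); first exact: VP.
    by rewrite opprD addrA addrAC.
  rewrite nrm_sqrB => h1; have [_ h2] := uP n.
  have : 2 * t * rdot (d - u n) v - t ^+ 2 * nrm v ^+ 2 <= n.+1%:R^-1 ^+ 2.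
    by move: h1 h2; set i := n.+1%:R^-1; lra.
  have -> : 2 * t * rdot (d - u n) v - t ^+ 2 * nrm v ^+ 2 =
      rdot (d - u n) v ^+ 2 / nrm v ^+ 2.
    by rewrite /t; field; rewrite gt_eqF.
  by rewrite ler_pdivrMr ?exprn_gt0// exprMn mulrC.
have le_inv m n : (m <= n)%N -> n.+1%:R^-1 <= m.+1%:R^-1 :> R.
  by move=> mn; rewrite lef_pV2 ?posrE ?ltr0n// ler_nat.
have [l lP] : exists l, forall m, nrm (l - u m) <= 2 / m.+1%:R.
  apply: (@cauchy_lim _ _ 2) => // m n mn.
  have Vd : V (u n - u m) by exact: VB.
  have := orth m _ Vd; have := orth n _ Vd; have := le_inv _ _ mn.
  (* The square is a difference of two inner products already bounded by [orth], which replaces the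
     parallelogram law. *)
  have : nrm (u n - u m) ^+ 2 =
      rdot (d - u m) (u n - u m) - rdot (d - u n) (u n - u m).
    by rewrite -rdotxx -rdotBl; congr rdot; rewrite opprB [RHS]addrC addrA subrK.
  set N := nrm _; have N0 : 0 <= N by exact: nrm_ge0.
  rewrite !ler_norml; set a := rdot _ _; set b := rdot _ _.
  set i := n.+1%:R^-1; set j := m.+1%:R^-1 => eN ij /andP[h1 h2] /andP[h3 h4].
  have [->|Nn] := eqVneq N 0; first by rewrite mulr_ge0// invr_ge0.
  have Np : 0 < N by rewrite lt_def Nn.
  rewrite -(@ler_pM2l _ N)//; nra.
exists l; split => [n|v Vv]; first by exists (u n).
have re0 w : V w -> rdot (d - l) w = 0.
  move=> Vw; apply/eqP; rewrite -normr_le0.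
  apply: (@le_inv_nat_le0 _ (3 * nrm w)) => n.
  have := orth n w Vw; have := rdot_le (l - u n) w; have := lP n.
  have := ler_normB (rdot (d - u n) w) (rdot (l - u n) w).
  rewrite -rdotBl opprB addrA subrK => h1 h2 h3 h4.
  have := ler_wpM2r (nrm_ge0 w) h2; set i := n.+1%:R^-1 in h2 h4 *.
  lra.
(* The vector i v turns the imaginary part into a real one. *)
have := re0 _ Vv; have := re0 _ (VZ 'i%C _ Vv); rewrite /rdot hdotZr.
case: (hdot _ _) => p q /=; simpc => h1 h2.
by apply/eqP; rewrite eq_complex /= h2 -h1 eqxx.
Qed.

End Projection.

(** * Riesz representation and adjoints *)

Section Adjoint.
Variable R : realType.
Implicit Types H K L : hilbertType R.

Lemma bop_exists H K (f : H -> K) (M : R) :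
  linear f -> (forall x, nrm (f x) <= M * nrm x) ->
  exists A : bounded_op H K, forall x, A x = f x.
Proof.
move=> lf bf.
have bf' : exists M' : R[i], forall x, `|f x| <= M' * `|x|.
  by exists M%:C%C => x; rewrite -!nrmE -rmorphM lecR.
by exists (BoundedOp lf bf').
Qed.

Lemma nrm_bound H K (A : bounded_op H K) :
  exists2 M : R, 0 <= M & forall x, nrm (A x) <= M * nrm x.
Proof.
have [M M0 AM] := bop_bound A.
have ME : (complex.Re M)%:C%C = M by rewrite RRe_real// ger0_real.
exists (complex.Re M); first by rewrite -ler0c ME.
by move=> x; rewrite -lecR rmorphM /= ME !nrmE.
Qed.

Lemma bop_fun0 H K (A : bounded_op H K) : A 0 = 0.
Proof. exact: raddf0. Qed.
Lemma bop_funD H K (A : bounded_op H K) x y : A (x + y) = A x + A y.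
Proof. exact: raddfD. Qed.
Lemma bop_funB H K (A : bounded_op H K) x y : A (x - y) = A x - A y.
Proof. exact: raddfB. Qed.
Lemma bop_funZ H K (A : bounded_op H K) (a : R[i]) x : A (a *: x) = a *: A x.
Proof. exact: linearZ. Qed.

Lemma bop_addE H K (A B : bounded_op H K) x : (A + B) x = A x + B x.
Proof. by []. Qed.
Lemma bop_oppE H K (A : bounded_op H K) x : (- A) x = - A x.
Proof. by []. Qed.
Lemma bop_subE H K (A B : bounded_op H K) x : (A - B) x = A x - B x.
Proof. by []. Qed.
Lemma bop_0E H K x : (0 : bounded_op H K) x = 0.
Proof. by []. Qed.
Lemma bop_compE H K L (A : bounded_op K L) (B : bounded_op H K) x :
  (A ** B) x = A (B x).
Proof. by []. Qed.
Lemma inclE H (S : closed_subspace H) (x : subspace S) : incl S x = val x.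
Proof. by []. Qed.
Lemma bop_MnE H K (A : bounded_op H K) n x : (A *+ n) x = A x *+ n.
Proof. by elim: n => [|n IH]; rewrite ?mulr0n// !mulrS bop_addE IH. Qed.

Definition bopE := (bop_addE, bop_subE, bop_oppE, bop_0E, bop_compE, bop_MnE).

Lemma subvalB H (S : closed_subspace H) (x y : subspace S) :
  val (x - y) = val x - val y.
Proof. exact: raddfB. Qed.

Lemma bop_compA H K L L' (A : bounded_op L L') (B : bounded_op K L)
  (C : bounded_op H K) : A ** (B ** C) = A ** B ** C.
Proof. exact: bopP. Qed.

Lemma bop_compBl H K L (A B : bounded_op K L) (C : bounded_op H K) :
  (A - B) ** C = A ** C - B ** C.
Proof. exact: bopP. Qed.

Lemma bop_compNl H K L (A : bounded_op K L) (C : bounded_op H K) :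
  (- A) ** C = - (A ** C).
Proof. exact: bopP. Qed.

Lemma bop_compBr H K L (A B : bounded_op H K) (C : bounded_op K L) :
  C ** (A - B) = C ** A - C ** B.
Proof. by apply: bopP => x; rewrite !bopE raddfB. Qed.

Lemma bop_compNr H K L (A : bounded_op H K) (C : bounded_op K L) :
  C ** (- A) = - (C ** A).
Proof. by apply: bopP => x; rewrite !bopE raddfN. Qed.

Lemma bop_comp0l H K L (C : bounded_op H K) : (0 : bounded_op K L) ** C = 0.
Proof. exact: bopP. Qed.

Lemma bop_comp0r H K L (C : bounded_op K L) : C ** (0 : bounded_op H K) = 0.
Proof. by apply: bopP => x; rewrite !bopE raddf0. Qed.

Let scale_linear H (a : R[i]) : linear (fun x : H => a *: x).
Proof. by move=> b x y; rewrite scalerDr !scalerA mulrC. Qed.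

Let scale_bounded H (a : R[i]) :
  exists M : R[i], forall x : H, `|a *: x| <= M * `|x|.
Proof. by exists `|a| => x; rewrite normrZ. Qed.

(** [bounded_op] carries only an additive structure, so scalar multiples are written as compositions
    with this operator. *)
Definition scale_op H (a : R[i]) : bounded_op H H :=
  BoundedOp (@scale_linear H a) (@scale_bounded H a).

Definition id_op H : bounded_op H H := scale_op H 1.

Lemma scale_opE H (a : R[i]) (x : H) : scale_op H a x = a *: x.
Proof. by []. Qed.

Lemma id_opE H (x : H) : id_op H x = x.
Proof. exact: scale1r. Qed.

Lemma bop_comp1l H K (A : bounded_op H K) : id_op K ** A = A.
Proof. by apply: bopP => x; rewrite bop_compE id_opE. Qed.

Lemma bop_comp1r H K (A : bounded_op H K) : A ** id_op H = A.
Proof. by apply: bopP => x; rewrite bop_compE id_opE. Qed.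

Lemma projection_unique H (S : closed_subspace H) (x : H) (s t : subspace S) :
  (forall y : subspace S, hdot (x - val s) (val y) = 0) ->
  (forall y : subspace S, hdot (x - val t) (val y) = 0) -> s = t.
Proof.
move=> sP tP; apply/val_inj/eqP; rewrite -subr_eq0 -raddfB.
apply/eqP/hdot_eq0; rewrite {1}raddfB.
have -> : val s - val t = (x - val t) - (x - val s).
  by rewrite opprB [RHS]addrC addrA subrK.
by rewrite hdotBl sP tP subrr.
Qed.

Lemma projP H (S : closed_subspace H) (x : H) (y : subspace S) :
  hdot (x - val (proj S x)) (val y) = 0.
Proof.
pose Q := [set P : bounded_op H (subspace S) |
  forall x (y : subspace S), hdot (x - val (P x)) (val y) = 0].
suff [P QP] : exists P, Q P by exact: (xgetI 0 QP).
have ex (d : H) : exists s : subspace S,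
    forall y : subspace S, hdot (d - val s) (val y) = 0.
  have [l [lS lo]] := nearest_point d (csub0 S) (@csubP _ _ S).
  have Sl := closed_approx lS.
  exists (SubVec (mem_set Sl)) => z; apply: lo; exact/set_mem/subval_in.
have [p pP] := choice ex.
have lp : linear p.
  move=> a u v; apply: (projection_unique (pP _)) => z; rewrite subvalP.
  have -> : a *: u + v - (a *: val (p u) + val (p v)) =
      a *: (u - val (p u)) + (v - val (p v)).
    by rewrite scalerBr opprD addrACA.
  by rewrite hdotDl hdotZl !pP mulr0 addr0.
have bp (d : H) : nrm (p d) <= 1 * nrm d.
  have : rdot (d - val (p d)) (val (p d)) = 0 by rewrite /rdot pP.
  rewrite rdotBl rdotxx => /eqP; rewrite subr_eq0 => /eqP e.
  have := rdot_le d (val (p d)); rewrite e.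
  have <- : nrm (p d) = nrm (val (p d)) by [].
  have := nrm_ge0 (p d); have := nrm_ge0 d; rewrite mul1r.
  set i := nrm d; set j := nrm _ => i0 j0.
  rewrite ger0_norm ?exprn_ge0// expr2 => h.
  have [->//|jn] := eqVneq j 0.
  by rewrite -(@ler_pM2r _ j)// lt_def jn.
have [P PE] := bop_exists lp bp.
by exists P => d z; rewrite PE.
Qed.

Lemma proj_eq H (S : closed_subspace H) (x : H) (s : subspace S) :
  (forall y : subspace S, hdot (x - val s) (val y) = 0) -> proj S x = s.
Proof.
exact/projection_unique/projP.
Qed.

(** If f d is nonzero, split d as l + e with l a limit of kernel vectors and e orthogonal to the
    kernel. Boundedness gives f l = 0, and then every x differs from (f x / f e) e by a kernel
    vector. *)
Lemma riesz H (f : H -> R[i]) (M : R) :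
  (forall a x y, f (a *: x + y) = a * f x + f y) ->
  (forall x, complex.Re `|f x| <= M * nrm x) ->
  exists z, forall x, f x = hdot x z.
Proof.
move=> lf bf.
have f0 : f 0 = 0.
  by have := lf (-1) 0 0; rewrite scaler0 addr0 mulN1r addNr.
have [[d fd]|/forallNP f0'] := pselect (exists d, f d != 0); last first.
  by exists 0 => x; rewrite hdot0r; apply/eqP; apply/negPn/negP/f0'.
have fZ a x : f (a *: x) = a * f x by rewrite -[a *: x]addr0 lf f0 addr0.
have fB x y : f (x - y) = f x - f y.
  by rewrite addrC -scaleN1r lf mulN1r addrC.
pose V := [set x | f x = 0].
have VP a x y : V x -> V y -> V (a *: x + y).
  by rewrite /V /= lf => -> ->; rewrite mulr0 addr0.
have [l [lV lo]] := nearest_point d f0 VP.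
have fl : f l = 0.
  have M0 : 0 <= `|M| by [].
  suff : complex.Re `|f l| <= 0.
    by rewrite -lecR RRe_real ?normr_real// normr_le0 => /eqP.
  apply: (@le_inv_nat_le0 _ (`|M| * 2)) => n.
  have [v fv lv] := lV n.
  have -> : f l = f (l - v) by rewrite fB fv subr0.
  apply: le_trans (bf _) _; rewrite -mulrA.
  apply: le_trans (ler_wpM2l M0 lv).
  by apply: ler_wpM2r; [exact: nrm_ge0|exact: ler_norm].
pose e := d - l.
have fe : f e != 0 by rewrite fB fl subr0.
have e0 : hdot e e != 0.
  by apply: contra fe => /eqP/hdot_eq0 ->; rewrite f0.
exists ((f e / hdot e e)^*%R *: e) => x.
rewrite hdotZr conjCK.
have : hdot (x - (f x / f e) *: e) e = 0.
  apply: hdot_sym0; apply: lo.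
  by rewrite /V /= fB fZ divfK// subrr.
rewrite hdotBl hdotZl => /eqP; rewrite subr_eq0 => /eqP ->.
by field; rewrite e0 fe.
Qed.

Lemma adjE H K (A : bounded_op H K) x y : hdot (A x) y = hdot x (adj A y).
Proof.
pose Q := [set B : bounded_op K H | forall x y, hdot (A x) y = hdot x (B y)].
suff [B QB] : exists B, Q B by exact: (xgetI 0 QB).
have [M M0 AM] := nrm_bound A.
have ex (w : K) : exists z, forall x, hdot (A x) w = hdot x z.
  apply: (@riesz _ _ (M * nrm w)) => [a u v|u].
    by rewrite linearP hdotDl hdotZl.
  apply: le_trans (CauchySchwarz _ _) _; rewrite mulrAC.
  by apply: ler_wpM2r => //; exact: nrm_ge0.
have [g gP] := choice ex.
have lg : linear g.
  move=> a u v; apply: hdot_ext => z; rewrite hdotC [RHS]hdotC; congr (_^*%R).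
  by rewrite -gP !hdotDr !hdotZr !gP.
have bg (w : K) : nrm (g w) <= M * nrm w.
  have : rdot (A (g w)) w = nrm (g w) ^+ 2 by rewrite /rdot gP hdotxx.
  have := rdot_le (A (g w)) w => /[swap] ->.
  have := ler_wpM2r (nrm_ge0 w) (AM (g w)).
  have := nrm_ge0 (g w); have := nrm_ge0 w.
  set i := nrm w; set j := nrm (g w); set k := nrm _ => i0 j0 h1.
  rewrite ger0_norm ?exprn_ge0// => h2.
  have [->|jn] := eqVneq j 0; first by rewrite mulr_ge0.
  have jp : 0 < j by rewrite lt_def jn.
  by rewrite -(@ler_pM2r _ j)// -expr2 mulrAC (le_trans h2).
have [B BE] := bop_exists lg bg.
by exists B => u v; rewrite BE.
Qed.

Lemma adjEr H K (A : bounded_op H K) x y : hdot (adj A x) y = hdot x (A y).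
Proof. by rewrite hdotC -adjE -hdotC. Qed.

Lemma hdot_extr H (x y : H) : (forall z, hdot z x = hdot z y) -> x = y.
Proof. by move=> h; apply: hdot_ext => z; rewrite hdotC h -hdotC. Qed.

Lemma adj_eq H K (A : bounded_op H K) (B : bounded_op K H) :
  (forall x y, hdot (A x) y = hdot x (B y)) -> adj A = B.
Proof. by move=> h; apply: bopP => y; apply: hdot_extr => x; rewrite -adjE. Qed.

Lemma adjK H K (A : bounded_op H K) : adj (adj A) = A.
Proof. by apply: adj_eq => x y; rewrite adjEr. Qed.

Lemma adjM H K L (A : bounded_op K L) (B : bounded_op H K) :
  adj (A ** B) = adj B ** adj A.
Proof. by apply: adj_eq => x y; rewrite !bopE !adjE. Qed.

Lemma adjD H K (A B : bounded_op H K) : adj (A + B) = adj A + adj B.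
Proof. by apply: adj_eq => x y; rewrite !bopE hdotDl hdotDr !adjE. Qed.

Lemma adjN H K (A : bounded_op H K) : adj (- A) = - adj A.
Proof. by apply: adj_eq => x y; rewrite !bopE hdotNl hdotNr !adjE. Qed.

Lemma adjB H K (A B : bounded_op H K) : adj (A - B) = adj A - adj B.
Proof. by rewrite adjD adjN. Qed.

Lemma adj0 H K : adj (0 : bounded_op H K) = 0.
Proof. by apply: adj_eq => x y; rewrite !bopE hdot0l hdot0r. Qed.

Lemma adj_id H : adj (id_op H) = id_op H.
Proof. by apply: adj_eq => x y; rewrite !id_opE. Qed.

Lemma adj_incl H (S : closed_subspace H) : adj (incl S) = proj S.
Proof.
apply: adj_eq => x y; rewrite inclE.
have := projP y x; rewrite hdotBl => /eqP; rewrite subr_eq0 => /eqP e.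
by rewrite hdotC e -hdotC.
Qed.

Lemma adj_proj H (S : closed_subspace H) : adj (proj S) = incl S.
Proof. by rewrite -adj_incl adjK. Qed.

Lemma proj_val H (S : closed_subspace H) (x : subspace S) :
  proj S (val x) = x.
Proof. by apply: proj_eq => y; rewrite subrr hdot0l. Qed.

Lemma subvalS H (S : closed_subspace H) (x : subspace S) : (S : set H) (val x).
Proof. exact/set_mem/subval_in. Qed.

Lemma proj_id H (S : closed_subspace H) (x : H) :
  (S : set H) x -> val (proj S x) = x.
Proof. by move=> Sx; rewrite -[x]/(val (SubVec (mem_set Sx))) proj_val. Qed.

Lemma proj_ortho H (S : closed_subspace H) (x : H) :
  orthoset S (x - val (proj S x)).
Proof.
by move=> y Sy; rewrite -[y]/(val (SubVec (mem_set Sy))) projP.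
Qed.

Lemma orthoset_self H (V : set H) (x : H) : V x -> orthoset V x -> x = 0.
Proof. by move=> Vx /(_ _ Vx)/hdot_eq0. Qed.

Lemma kernel_ortho H K (A : bounded_op H K) :
  kernel A = orthoset (range (adj A)).
Proof.
apply/seteqP; split => x /=.
  by move=> Ax _ [y _ <-]; rewrite -adjE Ax hdot0l.
by move=> h; apply: hdot_eq0; rewrite adjE h//; exists (A x).
Qed.

(** Taken as an orthogonal complement because [ortho_csub] supplies closedness. *)
Definition kernel_csub H K (A : bounded_op H K) : closed_subspace H :=
  ortho_csub (range (adj A)).

Lemma kernel_csubE H K (A : bounded_op H K) :
  (kernel_csub A : set H) = kernel A.
Proof. by rewrite kernel_ortho. Qed.

Lemma range_adj_ortho H K (A : bounded_op H K) y :
  orthoset (kernel A) (adj A y).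
Proof. by move=> x Ax; rewrite adjEr Ax hdot0r. Qed.

Lemma kernel_split H K (A : bounded_op H K) x :
  exists x0 x1, [/\ x = x0 + x1, A x0 = 0 & orthoset (kernel A) x1].
Proof.
exists (val (proj (kernel_csub A) x)), (x - val (proj (kernel_csub A) x)).
split; first by rewrite addrC subrK.
  by rewrite -[_ = 0]/(kernel A _) -kernel_csubE; exact: subvalS.
by rewrite -kernel_csubE; exact: proj_ortho.
Qed.

End Adjoint.

(** * Uniform boundedness and range inclusion *)

Section UniformBoundedness.
Variables (R : realType) (H : hilbertType R) (I : Type) (f : I -> H -> R).
Hypothesis fD : forall i x y, f i (x + y) <= f i x + f i y.
Hypothesis fN : forall i x, f i (- x) = f i x.
Hypothesis fZ : forall i (t : R) x, 0 <= t -> f i (t%:C%C *: x) = t * f i x.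
Hypothesis f_cont : forall i, exists C : R, forall x, f i x <= C * nrm x.
Hypothesis f_ptwise : forall x, exists C : R, forall i, f i x <= C.

(* Since 2 f w <= f (x + w) + f (x - w), one of x + w, x - w is the centre of a small ball
   on which f >= N; nested balls then meet in a point where f is unbounded. *)
Let shrink (N : nat) (x : H) (r : R) :
  (forall M : R, exists i x, M * nrm x < f i x) -> 0 < r ->
  exists xr : H * R, [/\ 0 < xr.2, xr.2 <= r / 2, nrm (xr.1 - x) <= r / 2 &
    exists i, forall z, nrm (z - xr.1) <= xr.2 -> N%:R <= f i z].
Proof.
move=> unbounded r0.
(* Rescaling y to length r / 2 makes f exceed N + 1; the extra 1 is what may be lost on the small
   ball. *)
have [i [y fy]] := unbounded ((N%:R + 1) * 2 / r).
have y0 : 0 < nrm y.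
  rewrite lt_def nrm_ge0 andbT; apply/negP => /eqP y0.
  move: fy; rewrite y0 mulr0 (nrm_eq0 y0).
  have := @fZ i 0 0 (lexx 0); rewrite scaler0 mul0r => ->.
  by rewrite ltxx.
pose t := r / 2 / nrm y.
have t0 : 0 < t by rewrite !divr_gt0.
pose w := t%:C%C *: y.
have nw : nrm w = r / 2.
  rewrite nrmZ ger0_norm ?lecR ?(ltW t0)//= /t divfK// gt_eqF//.
have fw : N%:R + 1 < f i w.
  rewrite fZ ?(ltW t0)//.
  have -> : N%:R + 1 = t * ((N%:R + 1) * 2 / r * nrm y).
    by rewrite /t; field; rewrite !gt_eqF.
  by rewrite ltr_pM2l.
have [x' [nx' fx']] : exists x', nrm (x' - x) = r / 2 /\ N%:R + 1 < f i x'.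
  have h : 2 * f i w <= f i (x + w) + f i (x - w).
    rewrite -fZ// -[in leRHS](fN i (x - w)).
    apply: le_trans (fD i _ _); rewrite le_eqVlt; apply/orP; left; apply/eqP.
    congr f; rewrite opprB [RHS]addrC addrA subrK.
    by rewrite rmorphD /= scalerDl scale1r.
  have [l|l] := ltP (N%:R + 1) (f i (x + w)).
    by exists (x + w); split => //; rewrite addrC addrA addNr add0r.
  exists (x - w); split; last by lra.
  by rewrite addrC addrA addNr add0r nrmN.
have [C fC] := f_cont i.
pose C' := `|C| + 1.
have C'0 : 0 < C' by rewrite /C' ltr_wpDl.
(* Within distance 1 / C' of x', f drops by at most 1. *)
exists (x', Num.min (r / 2) C'^-1); split => /=.
- by rewrite lt_min invr_gt0 C'0 divr_gt0.
- by rewrite ge_min lexx.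
- by rewrite nx'.
- exists i => z; rewrite le_min => /andP[_ zx].
  have : f i (x' - z) <= 1.
    apply: le_trans (fC _) _; rewrite nrm_subC.
    have CC' : C <= C' by rewrite (le_trans (ler_norm _))// lerDl.
    apply: le_trans (ler_wpM2r (nrm_ge0 _) CC') _.
    by rewrite mulrC -ler_pdivlMr// div1r.
  by have := fD i z (x' - z); rewrite addrC subrK; lra.
Qed.

Lemma uniform_boundedness :
  exists2 M : R, 0 <= M & forall i x, f i x <= M * nrm x.
Proof.
suff [M fM] : exists M : R, forall i x, f i x <= M * nrm x.
  exists `|M| => // i x; apply: le_trans (fM i x) _.
  by apply: ler_wpM2r; [exact: nrm_ge0|exact: ler_norm].
apply: contrapT => /forallNP unbounded'.
have unbounded (M : R) : exists i x, M * nrm x < f i x.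
  apply: contrapT => h; apply: (unbounded' M) => i x; rewrite leNgt.
  by apply/negP => fx; apply: h; exists i, x.
(* Positivity of the radius stands inside the conclusion so that [choice] yields a total step
   function; (0, 0) is a dummy value. *)
have ex (p : nat * (H * R)) : exists xr : H * R, 0 < p.2.2 ->
    [/\ 0 < xr.2, xr.2 <= p.2.2 / 2, nrm (xr.1 - p.2.1) <= p.2.2 / 2 &
    exists i, forall z, nrm (z - xr.1) <= xr.2 -> p.1%:R <= f i z].
  have [r0|r0] := pselect (0 < p.2.2); last by exists (0, 0) => /r0.
  by have [xr P] := shrink p.1 p.2.1 unbounded r0; exists xr.
have [step stepP] := choice ex.
pose st := fix st n := if n is n'.+1 then step (n', st n') else (0 : H, 1 : R).
have r0 n : 0 < (st n).2.
  by elim: n => [|n IH] //=; have [] := stepP (n, st n) IH.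
have sP n := stepP (n, st n) (r0 n).
(* This says that the balls are nested: each step moves the centre by at most half the radius and at
   least halves the radius. *)
have xn m n : (m <= n)%N ->
    nrm ((st n).1 - (st m).1) <= (st m).2 - (st n).2.
  elim: n => [|n IH]; first by rewrite leqn0 => /eqP ->; rewrite !subrr nrm0.
  rewrite leq_eqVlt => /predU1P[->|]; first by rewrite !subrr nrm0.
  rewrite ltnS => /IH h; have [_ /= h1 h2 _] := sP n.
  have := nrmD ((st n.+1).1 - (st n).1) ((st n).1 - (st m).1).
  rewrite addrA subrK; move: h1 h2 h => /=.
  set a := (step _).2; set b := nrm _; set c := nrm _; set d := nrm _.
  lra.
have rn n : (st n).2 <= 1 / n.+1%:R.
  elim: n => [|n IH]; first by rewrite divr1.
  have [_ /= h1 _ _] := sP n; apply: le_trans h1 _.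
  rewrite ler_pdivrMr//; apply: le_trans IH _.
  rewrite mulrAC ler_pdivlMr ?ltr0n// mulrAC ler_pdivrMr ?ltr0n// !mul1r.
  by rewrite -natrM ler_nat mul2n -addnn addSnnS leq_addl.
have [l lP] : exists l, forall m, nrm (l - (st m).1) <= (st m).2.
  apply: (cauchy_lim rn) => m n mn; apply: le_trans (xn m n mn) _.
  by rewrite gerBl ltW.
have [C fC] := f_ptwise l.
have [n Cn] : exists n : nat, C < n%:R.
  exists (Num.Def.archi_bound `|C|).
  exact: le_lt_trans (ler_norm _) (archi_boundP (normr_ge0 _)).
have [_ _ _ [i fi]] := sP n.
by have := le_lt_trans (le_trans (fi l (lP n.+1)) (fC i)) Cn; rewrite ltxx.
Qed.

End UniformBoundedness.

Section Douglas.
Variable R : realType.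
Implicit Types H K L : hilbertType R.

Lemma kernel_ortho_inj H K (A : bounded_op H K) x y :
  orthoset (kernel A) x -> orthoset (kernel A) y -> A x = A y -> x = y.
Proof.
move=> ox oy Axy; apply/eqP; rewrite -subr_eq0; apply/eqP.
have Ad : A (x - y) = 0 by rewrite bop_funB Axy subrr.
apply: (@orthoset_self _ _ (kernel A) _ Ad).
by move=> z /[dup] /ox xz /oy yz; rewrite hdotBl xz yz subrr.
Qed.

(** The nearest point l to x in the closure of the range of [adj A] is orthogonal to the kernel, as
    x is, while x - l is orthogonal to that range and so lies in the kernel. *)
Lemma range_adj_dense H K (A : bounded_op H K) x (n : nat) :
  orthoset (kernel A) x -> exists y, nrm (x - adj A y) <= 2 / n.+1%:R.
Proof.
move=> ox.
have V0 : range (adj A) 0 by exists 0 => //; rewrite raddf0.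
have VP a u v : range (adj A) u -> range (adj A) v -> range (adj A) (a *: u + v).
  by move=> [y _ <-] [z _ <-]; exists (a *: y + z) => //; rewrite linearP.
have [l [lV lo]] := nearest_point x V0 VP.
have ol : orthoset (kernel A) l.
  apply: (@closed_approx _ _ (ortho_csub (kernel A)) l 2) => k.
  have [_ [y _ <-] yl] := lV k.
  by exists (adj A y) => //; exact: range_adj_ortho.
have -> : x = l.
  apply: (kernel_ortho_inj ox ol); apply/eqP; rewrite -subr_eq0 -bop_funB.
  have : kernel A (x - l) by rewrite kernel_ortho.
  by move=> ->.
by have [_ [y _ <-] yl] := lV n; exists y.
Qed.

(* The functionals <., Y* z> / |X* z| are bounded at h by the norm of the solution d of
   X d = Y h; their uniform bound bounds |d| because R(X* ) is dense in N(X)^perp. *)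
Lemma douglas H K L (X : bounded_op K L) (Y : bounded_op H L) :
  range Y `<=` range X ->
  exists D : bounded_op H K, X ** D = Y /\ range D `<=` orthoset (kernel X).
Proof.
move=> YX.
have ex h : exists d, X d = Y h /\ orthoset (kernel X) d.
  have [d _ dY] : range X (Y h) by apply: YX; exists h.
  have [d0 [d1 [e X0 o1]]] := kernel_split X d.
  by exists d1; split => //; rewrite -dY e bop_funD X0 add0r.
have [g gP] := choice ex.
have gX h : X (g h) = Y h by have [] := gP h.
have go h : orthoset (kernel X) (g h) by have [] := gP h.
have lg : linear g.
  move=> a u v; apply: (kernel_ortho_inj (go _)).
    by apply: (@csubP _ _ (ortho_csub (kernel X))); exact: go.
  by rewrite bop_funD bop_funZ !gX bop_funD bop_funZ.
(* If [adj X z] is 0 the quotient is 0 by the convention for inverses, so every z can serve as an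
   index. *)
pose f z h := complex.Re `|hdot h (adj Y z)| / nrm (adj X z).
have fE h z : hdot h (adj Y z) = hdot (g h) (adj X z).
  by rewrite -!adjE gX.
have Re_norm (w : R[i]) : (complex.Re `|w|)%:C%C = `|w|.
  by rewrite RRe_real// normr_real.
have [M M0 fM] : exists2 M : R, 0 <= M & forall z h, f z h <= M * nrm h.
  apply: uniform_boundedness => [z x y|z x|z t x t0|z|x].
  - rewrite /f -mulrDl; apply: ler_wpM2r; first by rewrite invr_ge0 nrm_ge0.
    by rewrite -lecR rmorphD /= !Re_norm hdotDl ler_normD.
  - by rewrite /f hdotNl normrN.
  - rewrite /f mulrA; congr (_ / _); apply: complexI.
    by rewrite rmorphM /= !Re_norm hdotZl normrM ger0_norm// lecR.
  - exists (nrm (adj Y z) / nrm (adj X z)) => x; rewrite /f mulrAC.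
    apply: ler_wpM2r; first by rewrite invr_ge0 nrm_ge0.
    by rewrite mulrC CauchySchwarz.
  - exists (nrm (g x)) => z; rewrite /f fE.
    have [->|n0] := eqVneq (nrm (adj X z)) 0; first by rewrite invr0 mulr0 nrm_ge0.
    by rewrite ler_pdivrMr ?CauchySchwarz// lt_def n0 nrm_ge0.
have bg h : nrm (g h) <= M * nrm h.
  set d := g h.
  have dv z : rdot d (adj X z) <= M * nrm h * nrm (adj X z).
    apply: le_trans (ler_norm _) _.
    have [n0|n0] := eqVneq (nrm (adj X z)) 0.
      by apply: le_trans (rdot_le _ _) _; rewrite n0 !mulr0.
    have np : 0 < nrm (adj X z) by rewrite lt_def n0 nrm_ge0.
    have := fM z h; rewrite /f ler_pdivrMr// fE; apply: le_trans.
    by rewrite -lecR Re_norm normc_ge_Re.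
  have [->|d0] := eqVneq (nrm d) 0; first by rewrite mulr_ge0 ?nrm_ge0.
  have dp : 0 < nrm d by rewrite lt_def d0 nrm_ge0.
  rewrite -(@ler_pM2r _ (nrm d))// -subr_le0.
  (* Replacing d by a nearby [adj X z] in the inner product of d with itself costs norm d times
     their distance; the bound [dv] costs M times norm h times that distance. *)
  apply: (@le_inv_nat_le0 _ ((M * nrm h + nrm d) * 2)) => n.
  have [z dz] := range_adj_dense n (go h); rewrite -/d in dz.
  have Mh : 0 <= M * nrm h by rewrite mulr_ge0 ?nrm_ge0.
  have := dv z; have := rdot_le d (d - adj X z).
  have : nrm (adj X z) <= nrm d + nrm (d - adj X z).
    have := nrmD d (adj X z - d); rewrite addrC subrK.
    by rewrite (nrm_subC (adj X z)).
  rewrite rdotBr rdotxx ler_norml => h1 /andP[_ h2] h3.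
  move: h1 h2 h3 dz Mh dp.
  set a := nrm (d - _); set b := nrm (adj X z); set e := M * nrm h.
  set k := rdot _ _; rewrite -mulrA; set i := 2 / _; set j := nrm d.
  move=> h1 h2 h3 dz Mh dp.
  nra.
have [D DE] := bop_exists lg bg.
exists D; split; first by apply: bopP => h; rewrite bop_compE DE gX.
by move=> _ [h _ <-]; rewrite DE; exact: go.
Qed.

End Douglas.

(* An identity of vectors is checked after pairing with an arbitrary vector, where it
   becomes an identity in the commutative ring R[i]. *)
Ltac vector_ring :=
  apply: hdot_ext => ?; rewrite ?(hdotDl, hdotNl, hdotZl, hdot0l); ring.

(** * Limits of operators and the Neumann series *)

Section OperatorLimits.
Variable R : realType.
Implicit Types H K L : hilbertType R.

Lemma nrmZr H (t : R) (x : H) : 0 <= t -> nrm (t%:C%C *: x) = t * nrm x.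
Proof. by move=> t0; rewrite nrmZ ger0_norm ?lecR. Qed.

Lemma conjC_real_complex (t : R) : (t%:C%C)^*%R = t%:C%C :> R[i].
Proof. exact: conjc_real. Qed.

Lemma nrm_lim_eq H (x y : H) (c : R) :
  (forall n : nat, nrm (x - y) <= c / n.+1%:R) -> x = y.
Proof.
move=> h; apply/eqP; rewrite -subr_eq0; apply/eqP/nrm_eq0/eqP.
by rewrite eq_le nrm_ge0 (le_inv_nat_le0 h).
Qed.

Lemma rdot_ext H (x y : H) : (forall z, rdot x z = rdot y z) -> x = y.
Proof.
move=> h; apply/eqP; rewrite -subr_eq0; apply/eqP/nrm_eq0/eqP.
by rewrite -sqrf_eq0 -rdotxx rdotBl h subrr.
Qed.

(** Each step is bounded by a drop of r, so the steps telescope and r n bounds the remaining error.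
    This suits both the geometric Neumann series and the slowly converging root iteration. *)
Lemma oplim H K (Y : nat -> bounded_op H K) (r : nat -> R) (c : R) :
  (forall n, 0 <= r n) -> (forall n, r n <= c / n.+1%:R) ->
  (forall n x, nrm (Y n.+1 x - Y n x) <= (r n - r n.+1) * nrm x) ->
  exists Z : bounded_op H K, forall n x, nrm (Z x - Y n x) <= r n * nrm x.
Proof.
move=> r0 rc Ystep.
have Ycauchy m n x : (m <= n)%N -> nrm (Y n x - Y m x) <= (r m - r n) * nrm x.
  elim: n => [|n IH]; first by rewrite leqn0 => /eqP ->; rewrite !subrr nrm0 mul0r.
  rewrite leq_eqVlt => /predU1P[->|]; first by rewrite !subrr nrm0 mul0r.
  rewrite ltnS => /IH h; have := Ystep n x.
  have := nrmD (Y n.+1 x - Y n x) (Y n x - Y m x).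
  rewrite addrA subrK; lra.
have ex x : exists l, forall m, nrm (l - Y m x) <= r m * nrm x.
  apply: (@cauchy_lim _ _ (c * nrm x) (fun m => r m * nrm x)) => [m|m n mn].
    by rewrite mulrAC; apply: ler_wpM2r; rewrite ?nrm_ge0.
  apply: le_trans (Ycauchy m n x mn) _.
  by apply: ler_wpM2r; rewrite ?nrm_ge0// gerBl.
have [z zP] := choice ex.
have lz : linear z.
  move=> a u v.
  apply: (@nrm_lim_eq _ _ _
    (c * (nrm (a *: u + v) + complex.Re `|a| * nrm u + nrm v))) => n.
  rewrite mulrAC; apply: (@le_trans _ _ (r n *
      (nrm (a *: u + v) + complex.Re `|a| * nrm u + nrm v))).
    have -> : z (a *: u + v) - (a *: z u + z v) =
        (z (a *: u + v) - Y n (a *: u + v)) -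
        (a *: (z u - Y n u) + (z v - Y n v)).
      by rewrite bop_funD bop_funZ; vector_ring.
    apply: le_trans (nrmD _ _) _; rewrite nrmN.
    rewrite !mulrDr -addrA; apply: lerD => //.
    apply: le_trans (nrmD _ _) _; rewrite nrmZ mulrCA.
    apply: lerD => //; apply: ler_wpM2l => //.
    by rewrite -ler0c RRe_real ?normr_real.
  apply: ler_wpM2r => //; rewrite !addr_ge0 ?mulr_ge0 ?nrm_ge0//.
  by rewrite -ler0c RRe_real ?normr_real.
have [M M0 YM] := nrm_bound (Y 0).
have bz x : nrm (z x) <= (r 0%N + M) * nrm x.
  have := nrmD (z x - Y 0%N x) (Y 0%N x); rewrite subrK => /le_trans; apply.
  by rewrite mulrDl; apply: lerD.
have [Z ZE] := bop_exists lz bz.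
by exists Z => n x; rewrite ZE.
Qed.

(** The recursion Y_(n+1) = 1 - N Y_n produces the partial sums of the powers of -N. Its limit
    satisfies J = 1 - N J, a right inverse; commutation with N makes it two-sided. *)
Lemma neumann H (N : bounded_op H H) :
  (forall x, nrm (N x) <= 2^-1 * nrm x) ->
  exists J : bounded_op H H,
    (id_op H + N) ** J = id_op H /\ J ** (id_op H + N) = id_op H.
Proof.
move=> Nle.
pose Y : nat -> bounded_op H H :=
  fix Y n := if n is n'.+1 then id_op H - N ** Y n' else 0.
(* The first step is the identity and r 0 - r 1 = 1; after that both the steps and the drops of r
   halve. *)
pose r (n : nat) : R := 2 / 2 ^+ n.
have r0 n : 0 <= r n by rewrite divr_ge0 ?exprn_ge0.
have rS n : r n.+1 = r n / 2 by rewrite /r exprS invfM [2^-1 * _]mulrC mulrA.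
have rc n : r n <= 2 / n.+1%:R.
  rewrite ler_pM2l// lef_pV2 ?posrE ?ltr0n ?exprn_gt0// -natrX ler_nat.
  exact: ltn_expl.
have Y0' : Y 0%N = 0 by [].
have YS' n : Y n.+1 = id_op H - N ** Y n by [].
clearbody Y.
have Y0 x : Y 0%N x = 0 by rewrite Y0'.
have YS n x : Y n.+1 x = x - N (Y n x) by rewrite YS' bop_subE id_opE.
have Ystep n x : nrm (Y n.+1 x - Y n x) <= (r n - r n.+1) * nrm x.
  elim: n x => [|n IH] x.
    rewrite YS !Y0 bop_fun0 !subr0 /r expr0 expr1; lra.
  have -> : Y n.+2 x - Y n.+1 x = - N (Y n.+1 x - Y n x).
    by rewrite (YS n.+1) {2}YS bop_funB; vector_ring.
  rewrite nrmN; apply: le_trans (Nle _) _; have := IH x.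
  rewrite (rS n.+1) (rS n); lra.
have [J JP] := oplim r0 rc Ystep.
have small (x y z : H) (M : R) : 0 <= M ->
  (forall n : nat, nrm (y - z) <= M * r n * nrm x) -> y = z.
  move=> M0 h; apply: (@nrm_lim_eq _ _ _ (M * 2 * nrm x)) => n.
  apply: le_trans (h n) _; rewrite [leRHS]mulrAC; apply: ler_wpM2r; first exact: nrm_ge0.
  by rewrite -mulrA; apply: ler_wpM2l.
have JE x : J x = x - N (J x).
  apply: (small x _ _ 1) => // n; rewrite mul1r.
  have -> : J x - (x - N (J x)) = (J x - Y n.+1 x) + N (J x - Y n x).
    rewrite YS bop_funB.
    by vector_ring.
  apply: le_trans (nrmD _ _) _.
  have := JP n.+1 x; have := JP n x; have := Nle (J x - Y n x).
  rewrite rS; lra.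
have YN n : Y n ** N = N ** Y n.
  elim: n => [|n IH]; first by rewrite Y0' bop_comp0l bop_comp0r.
  rewrite YS' bop_compBl bop_compBr.
  by rewrite bop_comp1l bop_comp1r -IH bop_compA -IH.
have JN x : J (N x) = N (J x).
  apply: (small x _ _ 1) => // n; rewrite mul1r.
  have YNx : Y n (N x) = N (Y n x) by rewrite -!bop_compE YN.
  have -> : J (N x) - N (J x) = (J (N x) - Y n (N x)) - N (J x - Y n x).
    by rewrite YNx bop_funB opprB addrA subrK.
  apply: le_trans (nrmD _ _) _; rewrite nrmN.
  have := JP n (N x); have := JP n x; have := Nle (J x - Y n x); have := Nle x.
  have := r0 n; have := nrm_ge0 x; have := nrm_ge0 (N x); nra.
exists J; split; apply: bopP => x; rewrite !bopE !id_opE ?bop_funD.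
  by rewrite {1}JE subrK.
by rewrite JN {1}JE subrK.
Qed.

End OperatorLimits.

(** * Square roots *)

Section PositiveOperators.
Variable R : realType.
Implicit Types H K L : hilbertType R.

(** Complex polarization: x + y and x + i y give the vanishing of the sum and of the difference of
    the two mixed terms. Over the reals a quarter turn would be a counterexample. *)
Lemma quadratic_form_eq0 H (D : bounded_op H H) :
  (forall x, hdot (D x) x = 0) -> D = 0.
Proof.
move=> D0; apply: bopP => x; apply: hdot_ext => y; rewrite !bopE hdot0l.
have h1 := D0 (x + y); have h2 := D0 (x + 'i%C *: y).
rewrite !bop_funD !hdotDl !hdotDr !D0 add0r addr0 in h1.
rewrite !bop_funD !bop_funZ !hdotDl !hdotDr !hdotZl !hdotZr !D0 in h2.
rewrite !mulr0 add0r addr0 in h2.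
have h3 : hdot (D y) x = - hdot (D x) y.
  by apply/eqP; rewrite -addr_eq0 addrC h1.
have ic : ('i%C : R[i])^*%R = - 'i%C.
  by rewrite -[LHS]/(conjc 'i%C); apply/eqP; rewrite eq_complex /= oppr0 !eqxx.
move: h2; rewrite h3 ic mulNr mulrN -opprD => /eqP; rewrite oppr_eq0 -mulr2n.
rewrite mulrn_eq0 /= mulf_eq0 => /orP[|/eqP//].
by rewrite eq_complex /= oner_eq0 andbF.
Qed.

(** In R[i] the relation 0 <= a includes that a is real, so positivity makes the quadratic form of A
    - [adj A] vanish. *)
Lemma positive_opP H (A : bounded_op H H) :
  positive_op A <-> adj A = A /\ forall x, 0 <= rdot (A x) x.
Proof.
split=> [A0|[Aa A0] x].
  split=> [|x]; last first.
    by have := A0 x; rewrite lecE => /andP[].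
  apply/eqP; rewrite eq_sym -subr_eq0; apply/eqP/quadratic_form_eq0 => x.
  rewrite bop_subE hdotBl adjEr (hdotC x).
  have /CrealP -> : hdot (A x) x \is Num.real by rewrite ger0_real.
  by rewrite subrr.
have e : (hdot (A x) x)^*%R = hdot (A x) x by rewrite -hdotC -adjEr Aa.
rewrite lecE /= A0 andbT; move: e; case: (hdot _ _) => p q /= [] /eqP.
by rewrite eqNr.
Qed.

Lemma positive_adj H (A : bounded_op H H) : positive_op A -> adj A = A.
Proof. by move=> /positive_opP[]. Qed.

Lemma rdot_adj H K (A : bounded_op H K) x y : rdot (A x) y = rdot x (adj A y).
Proof. by rewrite /rdot adjE. Qed.

Lemma positive_conj H K (A : bounded_op H H) (V : bounded_op H K) :
  positive_op A -> positive_op (V ** A ** adj V).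
Proof. by move=> A0 x; rewrite !bopE adjE. Qed.

Lemma positive_gram H K (A : bounded_op H K) : positive_op (adj A ** A).
Proof. by move=> x; rewrite bop_compE adjEr hdotxx lecR exprn_ge0// nrm_ge0. Qed.

Lemma contraction_of_form H (X : bounded_op H H) :
  adj X = X -> (forall x, 0 <= rdot (X x) x <= nrm x ^+ 2) ->
  forall x, nrm (X x) <= nrm x.
Proof.
move=> Xa X01 x.
have X0 y : 0 <= rdot (X y) y by have /andP[] := X01 y.
have Xs y z : rdot (X y) z = rdot y (X z) by rewrite rdot_adj Xa.
(* X - X^2 = X (1 - X) X + (1 - X) X (1 - X) is positive *)
have h : nrm (X x) ^+ 2 <= rdot (X x) x.
  have /andP[_ h1] := X01 (X x); have h2 := X0 (x - X x).
  move: h2; rewrite bop_funB !rdotBl !rdotBr (Xs (X x) x) (Xs (X x) (X x)).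
  rewrite !rdotxx Xs in h1 *; rewrite -!rdotxx in h1 *; lra.
have /andP[_ h2] := X01 x.
by rewrite -(@ler_pXn2r _ 2%N) ?nnegrE ?nrm_ge0// (le_trans h).
Qed.

Section SquareRootIteration.
Variable y : nat -> R.
Hypothesis y0 : y 0%N = 0.
Hypothesis yS : forall n, y n.+1 = (1 + y n ^+ 2) / 2.

Lemma sqrt_iter01 n : 0 <= y n <= 1.
Proof.
elim: n => [|n /andP[i0 i1]]; first by rewrite y0 lexx ler01.
rewrite yS; apply/andP; split; nra.
Qed.

(** The sequence y is the scalar majorant of the iteration in [sqrt_contraction], with 1 in place of
    1 - A. Its fixed point 1 is a double root: d = 1 - y obeys d_(n+1) = d_n - d_n^2 / 2, which
    decays like 2 / n. The shift by 2 gives equality at n = 0. *)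
Lemma sqrt_iter_rate n : 1 - y n <= 2 / n.+2%:R.
Proof.
elim: n => [|n IH]; first by rewrite y0 subr0 divff ?pnatr_eq0.
have {}IH : (1 - y n) * n.+2%:R <= 2 by rewrite -ler_pdivlMr.
rewrite ler_pdivlMr// yS; have /andP[] := sqrt_iter01 n.
have e : n.+3%:R = n.+2%:R + 1 :> R by rewrite natr1.
have k2 : (2 : R) <= n.+2%:R by rewrite ler_nat.
rewrite e; move: (n.+2%:R : R) IH k2 => k; move: (y n) => u IH k2 u0 u1.
(* multiply by k^2 and put w = (1 - u) k <= 2: then w (2 k - w) <= 4 (k - 1) *)
have k0 : 0 < k ^+ 2 by rewrite exprn_gt0//; lra.
rewrite -(@ler_pM2r _ (k ^+ 2))//.
have w0 : 0 <= (2 - (1 - u) * k) * (2 * k - 2 - (1 - u) * k).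
  by rewrite mulr_ge0; lra.
have k1 : 0 <= k + 1 by lra.
have := mulr_ge0 w0 k1; nra.
Qed.

End SquareRootIteration.

(** With B = 1 - Z and X = 1 - A, the equation B^2 = A reads Z = (X + Z^2) / 2. The commutation
    clause, inherited from the iterates, is what [sqrt_op_unique] rests on. *)
Lemma sqrt_contraction H (A : bounded_op H H) : adj A = A ->
  (forall x, 0 <= rdot (A x) x <= nrm x ^+ 2) ->
  exists B : bounded_op H H, [/\ positive_op B, B ** B = A &
    forall C : bounded_op H H, C ** A = A ** C -> C ** B = B ** C].
Proof.
move=> Aa A01.
pose X : bounded_op H H := id_op H - A.
have Xa : adj X = X by rewrite adjB adj_id Aa.
have Xle : forall x, nrm (X x) <= nrm x.
  apply: contraction_of_form => // x; rewrite bop_subE id_opE rdotBl rdotxx.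
  have /andP[] := A01 x; lra.
pose h : R[i] := (2^-1 : R)%:C%C.
pose Y : nat -> bounded_op H H := fix Y n := if n is n'.+1 then
  scale_op H h ** (X + Y n' ** Y n') else 0.
pose y := fix y n : R := if n is n'.+1 then (1 + y n' ^+ 2) / 2 else 0.
have Y0' : Y 0%N = 0 by [].
have Y0 x : Y 0%N x = 0 by [].
have YS n x : Y n.+1 x = h *: (X x + Y n (Y n x)) by [].
have y0 : y 0%N = 0 by [].
have yS n : y n.+1 = (1 + y n ^+ 2) / 2 by [].
clearbody Y y.
have y01 : forall n, 0 <= y n <= 1 := sqrt_iter01 y0 yS.
have yc : forall n, 1 - y n <= 2 / n.+2%:R := sqrt_iter_rate y0 yS.
pose r n := 1 - y n.
have r0 n : 0 <= r n by rewrite /r subr_ge0; have /andP[] := y01 n.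
have rc n : r n <= 2 / n.+1%:R.
  apply: le_trans (yc n) _; rewrite ler_pM2l// lef_pV2 ?posrE ?ltr0n//.
  by rewrite ler_nat.
have Yle n x : nrm (Y n x) <= y n * nrm x.
  elim: n x => [|n IH] x; first by rewrite Y0 y0 nrm0 mul0r.
  rewrite YS nrmZr ?invr_ge0// yS.
  have := nrmD (X x) (Y n (Y n x)); have := Xle x.
  have := IH (Y n x); have := IH x.
  have /andP[] := y01 n; have := nrm_ge0 x; nra.
(* With a = Y_(n+1) and b = Y_n, a^2 - b^2 = a (a - b) + (a - b) b, and the same factorisation holds
   for the scalar majorants. *)
have Ystep n x : nrm (Y n.+1 x - Y n x) <= (r n - r n.+1) * nrm x.
  have -> : r n - r n.+1 = y n.+1 - y n by rewrite /r; ring.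
  elim: n x => [|n IH] x.
    rewrite YS !Y0 addr0 subr0 nrmZr ?invr_ge0// yS y0.
    have := Xle x; lra.
  have -> : Y n.+2 x - Y n.+1 x = h *: (Y n.+1 (Y n.+1 x - Y n x) +
      (Y n.+1 (Y n x) - Y n (Y n x))).
    by rewrite !(YS _ x) bop_funB -scalerBr addrA subrK opprD addrACA subrr add0r.
  rewrite nrmZr ?invr_ge0//.
  have := nrmD (Y n.+1 (Y n.+1 x - Y n x)) (Y n.+1 (Y n x) - Y n (Y n x)).
  have := IH (Y n x); have := Yle n.+1 (Y n.+1 x - Y n x).
  have /andP[a0 _] := y01 n.+1; have b1 := y01 n.
  have ba : 0 <= y n.+1 - y n by rewrite yS; nra.
  have := ler_wpM2l a0 (IH x); have := ler_wpM2l ba (Yle n x).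
  have : y n.+1 * nrm x = (1 + y n ^+ 2) / 2 * nrm x by rewrite yS.
  rewrite (yS n.+1); set a := y n.+1; set b := y n.
  set u := nrm _; set v := nrm _; set w := nrm _; set m := nrm _; set l := nrm _.
  set o := nrm _; lra.
have [Z ZP] := oplim r0 rc Ystep.
have small (x v w : H) (M : R) : 0 <= M ->
  (forall n : nat, nrm (v - w) <= M * r n * nrm x) -> v = w.
  move=> M0 hM; apply: (@nrm_lim_eq _ _ _ _ (M * 2 * nrm x)) => n.
  apply: le_trans (hM n) _; rewrite [leRHS]mulrAC; apply: ler_wpM2r; first exact: nrm_ge0.
  by rewrite -mulrA; apply: ler_wpM2l.
have Zle x : nrm (Z x) <= nrm x.
  have := nrmD (Z x - Y 0%N x) (Y 0%N x); rewrite subrK.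
  have := ZP 0%N x; have := Yle 0%N x; rewrite /r; lra.
have rS n : r n.+1 <= r n.
  rewrite /r yS; have /andP[] := y01 n; set u := y n; nra.
(* Subtracting the recurrence for Y_(n+1) leaves errors of at most r n and r (n + 1) <= r n, whence
   the factor 2. *)
have Z2 x : h *: (X x + Z (Z x)) = Z x.
  apply: (small x _ _ 2) => // n.
  have -> : h *: (X x + Z (Z x)) - Z x =
      h *: (Z (Z x - Y n x) + (Z (Y n x) - Y n (Y n x))) - (Z x - Y n.+1 x).
    by rewrite YS bop_funB; vector_ring.
  apply: le_trans (nrmD _ _) _; rewrite nrmN nrmZr ?invr_ge0//.
  have := nrmD (Z (Z x - Y n x)) (Z (Y n x) - Y n (Y n x)).
  have := Zle (Z x - Y n x); have := ZP n x; have := ZP n (Y n x).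
  have := ZP n.+1 x; have := ler_wpM2r (nrm_ge0 x) (rS n).
  have Yn1 : nrm (Y n x) <= nrm x.
    apply: le_trans (Yle n x) _; have /andP[_ h1] := y01 n.
    by have := ler_wpM2r (nrm_ge0 x) h1; rewrite mul1r.
  have := ler_wpM2l (r0 n) Yn1; lra.
have Ya n : adj (Y n) = Y n.
  elim: n => [|n IH]; first by rewrite Y0' adj0.
  apply: bopP => x; apply: hdot_ext => z; rewrite adjEr !YS hdotZl hdotZr.
  rewrite hdotDl hdotDr -!(adjEr (Y n)) !IH -(adjEr X) Xa; congr (_ * _).
  exact: conjC_real_complex.
have Za : adj Z = Z.
  apply/bopP => x; apply: rdot_ext => z; rewrite rdotC -rdot_adj rdotC.
  apply/eqP; rewrite -subr_eq0 -normr_le0.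
  apply: (@le_inv_nat_le0 _ (4 * (nrm x * nrm z))) => n.
  have -> : rdot x (Z z) - rdot (Z x) z =
      rdot (Z z - Y n z) x - rdot (Z x - Y n x) z.
    rewrite !rdotBl (rdotC x) (rdot_adj (Y n) z) Ya (rdotC z); ring.
  apply: le_trans (ler_normB _ _) _.
  have := rdot_le (Z z - Y n z) x; have := rdot_le (Z x - Y n x) z.
  have := ler_wpM2r (nrm_ge0 x) (ZP n z); have := ler_wpM2r (nrm_ge0 z) (ZP n x).
  have := ler_wpM2r (mulr_ge0 (nrm_ge0 x) (nrm_ge0 z)) (rc n).
  set i := 2 / _ => h1 h2 h3 h4 h5.
  have -> : 4 * (nrm x * nrm z) / n.+1%:R = 2 * (i * (nrm x * nrm z)).
    by rewrite /i; set k := _^-1; ring.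
  move: h1 h2 h3 h4 h5; set k := nrm (_ - _); set l := nrm (_ - _); lra.
have Zc (C : bounded_op H H) : C ** A = A ** C -> C ** Z = Z ** C.
  move=> CA.
  have Cx u : C (A u) = A (C u) by rewrite -!bop_compE CA.
  have CY n u : C (Y n u) = Y n (C u).
    elim: n u => [|n IH] u; first by rewrite !Y0 bop_fun0.
    by rewrite !YS bop_funZ bop_funD !IH /X !bop_subE !id_opE bop_funB Cx.
  have [M M0 CM] := nrm_bound C.
  apply: bopP => x; rewrite !bop_compE; apply: (small x _ _ (M + M)).
    exact: addr_ge0.
  move=> n.
  have -> : C (Z x) - Z (C x) = C (Z x - Y n x) - (Z (C x) - Y n (C x)).
    by rewrite bop_funB CY opprB addrA subrK.
  apply: le_trans (nrmD _ _) _; rewrite nrmN.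
  have := CM (Z x - Y n x); have := ler_wpM2l M0 (ZP n x).
  have := ZP n (C x); have := ler_wpM2l (r0 n) (CM x); lra.
exists (id_op H - Z); split.
- apply/positive_opP; split; first by rewrite adjB adj_id Za.
  move=> x; rewrite bop_subE id_opE rdotBl rdotxx subr_ge0.
  have := rdot_le (Z x) x; have := Zle x; have := nrm_ge0 x.
  rewrite ler_norml => h1 h2 /andP[_ h3]; nra.
- apply: bopP => x; rewrite !bopE !id_opE bop_funB.
  have e : Z (Z x) = Z x + Z x - (x - A x).
    have hh : h + h = 1.
      have e : (2^-1 + 2^-1 : R) = 1 by field.
      by rewrite /h -rmorphD /= e.
    have : Z x + Z x = X x + Z (Z x) by rewrite -{1 2}(Z2 x) -scalerDl hh scale1r.
    by rewrite /X bop_subE id_opE => ->; vector_ring.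
  rewrite e; vector_ring.
- by move=> C /Zc CZ; rewrite bop_compBl bop_compBr bop_comp1l bop_comp1r CZ.
Qed.

End PositiveOperators.

Section SquareRoot.
Variable R : realType.
Implicit Types H K L : hilbertType R.

(** Division by M + 1, with M a bound of A, reduces to the contractive case; the 1 keeps the divisor
    positive when M = 0. *)
Lemma sqrt_op_exists H (A : bounded_op H H) : positive_op A ->
  exists B : bounded_op H H, [/\ positive_op B, B ** B = A &
    forall C : bounded_op H H, C ** A = A ** C -> C ** B = B ** C].
Proof.
move=> /positive_opP[Aa A0].
have [M M0 AM] := nrm_bound A.
have c0 : 0 < M + 1 by rewrite ltr_wpDl.
have cV0 : 0 <= (M + 1)^-1 by rewrite invr_ge0 ltW.
pose d : R[i] := ((M + 1)^-1)%:C%C.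
pose A' : bounded_op H H := scale_op H d ** A.
have A'E x : A' x = d *: A x by [].
clearbody A'.
have A'a : adj A' = A'.
  apply: adj_eq => x y; rewrite !A'E hdotZl hdotZr conjC_real_complex.
  by rewrite adjE Aa.
have A'01 x : 0 <= rdot (A' x) x <= nrm x ^+ 2.
  rewrite A'E rdotZl mulr_ge0//= mulrC ler_pdivrMr//.
  have := rdot_le (A x) x; rewrite ler_norml => /andP[_].
  have := ler_wpM2r (nrm_ge0 x) (AM x); have := nrm_ge0 x; nra.
have [B' [/positive_opP[B'a B'0] B'B' B'C]] := sqrt_contraction A'a A'01.
pose s := Num.sqrt (M + 1).
have s0 : 0 <= s by rewrite sqrtr_ge0.
have ss : s * s = M + 1 by rewrite -expr2 sqr_sqrtr// ltW.
pose B : bounded_op H H := scale_op H s%:C%C ** B'.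
have BE x : B x = s%:C%C *: B' x by [].
clearbody B.
exists B; split.
- apply/positive_opP; split=> [|x]; last by rewrite BE rdotZl mulr_ge0.
  apply: adj_eq => x y; rewrite !BE hdotZl hdotZr conjC_real_complex.
  by rewrite adjE B'a.
- apply: bopP => x; rewrite bop_compE !BE bop_funZ scalerA.
  rewrite -bop_compE B'B' A'E scalerA -!rmorphM /= ss divff ?gt_eqF//.
  by rewrite scale1r.
- move=> C CA; have CA' : C ** A' = A' ** C.
    apply: bopP => x; rewrite !bop_compE !A'E bop_funZ.
    by rewrite -!bop_compE CA.
  apply: bopP => x; rewrite !bop_compE !BE bop_funZ.
  by rewrite -!bop_compE (B'C _ CA').
Qed.

Lemma selfadj_kernel H (s : bounded_op H H) x :
  adj s = s -> s (s x) = 0 -> s x = 0.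
Proof. by move=> sa ssx; apply: hdot_eq0; rewrite adjE sa ssx hdot0r. Qed.

Lemma selfadj_range_ortho H (s : bounded_op H H) x :
  adj s = s -> orthoset (kernel s) (s x).
Proof. by move=> sa; have := @range_adj_ortho _ _ _ s x; rewrite sa. Qed.

Lemma positive_kernel H (B : bounded_op H H) x :
  positive_op B -> hdot (B x) x = 0 -> B x = 0.
Proof.
move=> /sqrt_op_exists[s [/positive_adj sa <- _]].
rewrite bop_compE adjE sa => /hdot_eq0 sx.
by rewrite sx bop_fun0.
Qed.

(* y = (B - C) x satisfies <B y, y> + <C y, y> = <(B^2 - C^2) x, y> = 0, so B y = C y = 0
   by positivity, and |y|^2 = <x, (B - C) y> = 0. *)
Lemma sqrt_op_unique_commuting H (B C : bounded_op H H) :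
  positive_op B -> positive_op C -> C ** B = B ** C -> B ** B = C ** C -> B = C.
Proof.
move=> B0 C0 CB BC.
have CBx x : C (B x) = B (C x) by rewrite -!bop_compE CB.
have BBx x : B (B x) = C (C x) by rewrite -!bop_compE BC.
apply: bopP => x; apply/eqP; rewrite -subr_eq0; apply/eqP/hdot_eq0.
set y := B x - C x.
have sum0 : hdot (B y) y + hdot (C y) y = 0.
  rewrite -hdotDl (_ : B y + C y = 0) ?hdot0l//.
  by rewrite /y !bop_funB CBx BBx; vector_ring.
have [By Cy] : B y = 0 /\ C y = 0.
  have := sum0 => /eqP; rewrite paddr_eq0 ?B0 ?C0// => /andP[/eqP h1 /eqP h2].
  by split; apply: positive_kernel.
by rewrite {1}/y hdotBl !adjE (positive_adj B0) (positive_adj C0) By Cy subrr.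
Qed.

(** The constructed root of B^2 commutes with whatever commutes with B^2 = C^2, hence with B and
    with C; the commuting case identifies both with it. *)
Lemma sqrt_op_unique H (B C : bounded_op H H) :
  positive_op B -> positive_op C -> B ** B = C ** C -> B = C.
Proof.
move=> B0 C0 BC; have := @positive_gram _ _ _ B; rewrite (positive_adj B0).
move=> /sqrt_op_exists[S [S0 SS Sc]].
have -> : B = S.
  by apply/esym/sqrt_op_unique_commuting => //; apply: Sc; rewrite bop_compA.
apply: sqrt_op_unique_commuting => //; last by rewrite SS.
by apply: Sc; rewrite BC bop_compA.
Qed.

Lemma sqrt_op_eq H (A B : bounded_op H H) :
  positive_op B -> B ** B = A -> sqrt_op A = B.
Proof.
move=> B0 BB.
have [S0 SS] := @xgetI _ 0 [set B | positive_op B /\ B ** B = A] B (conj B0 BB).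
by apply: sqrt_op_unique => //; rewrite BB.
Qed.

Lemma sqrt_opP H (A : bounded_op H H) : positive_op A ->
  positive_op (sqrt_op A) /\ sqrt_op A ** sqrt_op A = A.
Proof.
by move=> /sqrt_op_exists[B [B0 BB _]]; rewrite (sqrt_op_eq B0 BB).
Qed.

Lemma abs_opP H K (A : bounded_op H K) :
  positive_op (abs_op A) /\ abs_op A ** abs_op A = adj A ** A.
Proof. exact/sqrt_opP/positive_gram. Qed.

Lemma abs_op_adj H K (A : bounded_op H K) : adj (abs_op A) = abs_op A.
Proof. by apply: positive_adj; case: (abs_opP A). Qed.

Lemma hdot_abs_op H K (A : bounded_op H K) x y :
  hdot (abs_op A x) (abs_op A y) = hdot (A x) (A y).
Proof.
rewrite adjE abs_op_adj -bop_compE; have [_ ->] := abs_opP A.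
by rewrite bop_compE -adjE.
Qed.

Lemma abs_op_kernel H K (A : bounded_op H K) : kernel (abs_op A) = kernel A.
Proof.
apply/seteqP; split => x /= k0; apply: hdot_eq0.
  by rewrite -hdot_abs_op k0 hdot0l.
by rewrite hdot_abs_op k0 hdot0l.
Qed.

End SquareRoot.

(** * Polar decomposition and shorted operators *)

Section Polar.
Variable R : realType.
Implicit Types H K L : hilbertType R.

Lemma hsum_hdotE H K (x y : hsum H K) :
  hdot x y = hdot x.1 y.1 + hdot x.2 y.2 :> R[i].
Proof. by []. Qed.

Lemma hsum_nrm2_le H K (x : hsum H K) : nrm x.2 <= nrm x.
Proof. by rewrite -lecR !nrmE hsum_norm2_le. Qed.

(* The closure G of the graph {(|A| x, A x)} is obtained as a double orthogonal; for h
   orthogonal to N(A), the projection of (h, 0) onto G is half of (h, U h). *)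
Lemma polar_exists H K (A : bounded_op H K) : exists U : bounded_op H K,
  [/\ partial_isometry U, kernel U = kernel A & A = U ** abs_op A].
Proof.
pose pt (x : H) (y : K) : hsum H K := (x, y).
pose G0 : set (hsum H K) := range (fun x => pt (abs_op A x) (A x)).
pose G := ortho_csub (orthoset G0).
have GP (g u : hsum H K) : (G : set _) g -> orthoset G0 u -> hdot g u = 0.
  by move=> Gg Gu; apply: Gg.
have G0G x : (G : set _) (pt (abs_op A x) (A x)).
  by move=> u Gu; apply: hdot_sym0; apply: Gu; exists x.
(* Equality of inner products passes from the graph to its closure one argument at a time: (|A| x, -
   A x) is orthogonal to the graph, and then so is (u.1, - u.2) for each u in G. *)
have GF (g : hsum H K) x : (G : set _) g -> hdot g.1 (abs_op A x) = hdot g.2 (A x).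
  move=> Gg; have := GP g (pt (abs_op A x) (- A x)) Gg.
  rewrite hsum_hdotE /= hdotNr => h; apply/eqP; rewrite -subr_eq0 h//.
  move=> _ [y _ <-]; rewrite hsum_hdotE /= hdotNl hdot_abs_op subrr//.
have GN (g : hsum H K) : (G : set _) g -> orthoset (kernel A) g.1.
  move=> Gg n An; have := GP g (pt n 0) Gg.
  rewrite hsum_hdotE /= hdot0r addr0 => -> // _ [y _ <-].
  have n0 : abs_op A n = 0 by rewrite -[_ = _]/(kernel _ n) abs_op_kernel.
  by rewrite hsum_hdotE /= hdot0l addr0 -{1}abs_op_adj -adjE n0 hdot0l.
have GI (g u : hsum H K) : (G : set _) g -> (G : set _) u ->
    hdot g.1 u.1 = hdot g.2 u.2.
  move=> Gg Gu; have := GP g (pt u.1 (- u.2)) Gg.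
  rewrite hsum_hdotE /= hdotNr => h; apply/eqP; rewrite -subr_eq0 h//.
  move=> _ [x _ <-]; rewrite hsum_hdotE /= hdotNl GF// subrr//.
pose P h : hsum H K := val (proj G (pt h 0)).
have GPh h : (G : set _) (P h) by exact: subvalS.
have Pl : linear P.
  move=> a x y; rewrite /P -subvalP; congr val.
  rewrite -bop_funZ -bop_funD; congr (proj G _).
  by rewrite /pt; congr (_, _); rewrite /= scaler0 addr0.
(* For h orthogonal to the kernel, (h, 0) is half of (h, U h) plus half of (h, - U h), and the
   latter is orthogonal to G; hence the doubling. *)
pose f h : K := (P h).2 + (P h).2.
have fl : linear f.
  by move=> a x y; rewrite /f Pl /= scalerDr addrACA.
have [M fb] : exists M : R, forall h, nrm (f h) <= M * nrm h.
  have [M M0 bM] := nrm_bound (proj G); exists (M + M) => h.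
  have e : nrm (pt h 0) = nrm h.
    have : hdot (pt h 0) (pt h 0) = hdot h h by rewrite hsum_hdotE /= hdot0l addr0.
    by rewrite !hdotxx => /complexI/eqP; rewrite eqrXn2 ?nrm_ge0// => /eqP.
  have b2 : nrm (P h).2 <= M * nrm h.
    by rewrite (le_trans (hsum_nrm2_le _))// -e; exact: bM.
  by rewrite mulrDl (le_trans (nrmD _ _))// lerD.
have [U UE] := bop_exists fl fb.
have GU h : orthoset (kernel A) h -> (G : set _) (pt h (U h)).
  move=> oh; set g := P h.
  have hg : h = g.1 + g.1.
    apply: (@kernel_ortho_inj _ _ _ (abs_op A)); rewrite ?abs_op_kernel//.
      by move=> n An; rewrite hdotDl (GN g (GPh h))// addr0.
    apply: hdot_ext => x; rewrite !adjE abs_op_adj.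
    have : hdot (pt h 0 - g) (pt (abs_op A x) (A x)) = 0.
      by have := @proj_ortho _ _ G (pt h 0) _ (G0G x).
    rewrite hsum_hdotE /= hdotBl hdotDl sub0r hdotNl -(GF _ x (GPh h)) -/g => e.
    by apply/eqP; rewrite -subr_eq0 opprD addrA e.
  have -> : pt h (U h) = 1 *: g + g.
    by rewrite scale1r UE /f -/g [in LHS]hg; case: (g).
  by apply: csubP; exact: GPh.
have U0 n : A n = 0 -> U n = 0.
  move=> An; rewrite UE /f.
  have v0 : val (0 : subspace G) = 0 :> hsum H K by exact: raddf0.
  have Pn : proj G (pt n 0) = 0.
    apply: proj_eq => u; rewrite v0 subr0 hsum_hdotE /= hdot0l addr0.
    by apply: hdot_sym0; apply: (GN _ (subvalS u)).
  by rewrite /P Pn v0 addr0.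
have iso h : orthoset (kernel A) h -> hdot (U h) (U h) = hdot h h.
  by move=> oh; rewrite -(GI _ _ (GU h oh) (GU h oh)).
have kU : kernel U = kernel A.
  apply/seteqP; split => h; last exact: U0.
  move=> Uh; have [h0 [h1 [e A0 o1]]] := kernel_split A h.
  have : U h1 = 0 by rewrite -Uh e bop_funD (U0 _ A0) add0r.
  move=> Uh1; have := iso _ o1; rewrite Uh1 hdot0l => /esym/hdot_eq0 h10.
  by rewrite e h10 addr0.
exists U; split => //.
- move=> h; rewrite kU => oh; rewrite -!nrmE; congr (_%:C%C).
  have := iso h oh; rewrite !hdotxx => /complexI/eqP.
  by rewrite eqrXn2 ?nrm_ge0// => /eqP.
- apply: bopP => x; rewrite bop_compE.
  have o : orthoset (kernel A) (abs_op A x).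
    by rewrite -abs_op_kernel; exact/selfadj_range_ortho/abs_op_adj.
  (* Components of vectors of G have equal norms, so a vector of G with first component 0
     vanishes. *)
  have Gd : (G : set _) (pt 0 (U (abs_op A x) - A x)).
    have := @csubP _ _ G (-1) _ _ (G0G x) (GU _ o).
    congr (_ _); congr (_, _); rewrite /= scaleN1r; first by rewrite addNr.
    by rewrite addrC.
  have := GI _ _ Gd Gd; rewrite /= hdot0l => /esym/hdot_eq0/eqP.
  by rewrite subr_eq0 => /eqP.
Qed.

Lemma polarP H K (A : bounded_op H K) :
  [/\ partial_isometry (polar A), kernel (polar A) = kernel A &
      A = polar A ** abs_op A].
Proof.
have [U UP] := polar_exists A.
exact: (@xgetI _ 0 [set U : bounded_op H K |
  [/\ partial_isometry U, kernel U = kernel A & A = U ** abs_op A]] U UP).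
Qed.

Lemma partial_isometryK H K (U : bounded_op H K) x : partial_isometry U ->
  orthoset (kernel U) x -> adj U (U x) = x.
Proof.
move=> iU ox; apply: rdot_ext => z.
have [z0 [z1 [-> Uz0 o1]]] := kernel_split U z.
rewrite /rdot adjEr hdotDr bop_funD Uz0 add0r (ox _ Uz0) add0r -!/(rdot _ _).
have nU y : orthoset (kernel U) y -> rdot (U y) (U y) = rdot y y.
  by move=> oy; rewrite !rdotxx /nrm iU.
have := nU _ (@csubP _ _ (ortho_csub (kernel U)) 1 _ _ ox o1).
rewrite scale1r bop_funD !rdotDl ![rdot _ (_ + _)]rdotC !rdotDl !nU//.
rewrite [rdot (U z1) (U x)]rdotC [rdot z1 x]rdotC; lra.
Qed.

(** With U the polar factor, [adj U] undoes U on the range of |A|, so the square of the right side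
    is U |A|^2 [adj U], that is A [adj A]; uniqueness of positive roots concludes. *)
Lemma abs_op_adj_polar H K (A : bounded_op H K) :
  abs_op (adj A) = polar A ** abs_op A ** adj (polar A).
Proof.
have [iU kU AU] := polarP A; have [M0 MM] := abs_opP A.
apply: sqrt_op_eq; first exact: positive_conj.
apply: bopP => x; rewrite adjK !bop_compE partial_isometryK//; last first.
  by rewrite kU -abs_op_kernel; exact/selfadj_range_ortho/abs_op_adj.
have AUE y : A y = polar A (abs_op A y) by rewrite -bop_compE -AU.
rewrite AUE; congr (polar A (abs_op A _)); apply: hdot_extr => y.
by rewrite -[RHS]adjE AUE !adjE abs_op_adj.
Qed.

(** This moves the polar factor to the left in the equation defining E, so that both reduced
    solutions involve the same root. *)
Lemma sqrt_abs_polar H K (A : bounded_op H K) :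
  sqrt_op (abs_op (adj A)) ** polar A = polar A ** sqrt_op (abs_op A).
Proof.
have [iU kU AU] := polarP A; have [M0 MM] := abs_opP A.
have [s0 ss] := sqrt_opP M0; set s := sqrt_op (abs_op A) in s0 ss *.
have sa := positive_adj s0.
have UU x : adj (polar A) (polar A (s x)) = s x.
  apply: partial_isometryK => //; rewrite kU => n An.
  rewrite adjE sa (_ : s n = 0) ?hdot0r//; apply: selfadj_kernel => //.
  by rewrite -bop_compE ss; have : kernel (abs_op A) n by rewrite abs_op_kernel.
have -> : sqrt_op (abs_op (adj A)) = polar A ** s ** adj (polar A).
  apply: sqrt_op_eq; first exact: positive_conj.
  apply: bopP => x; rewrite abs_op_adj_polar !bop_compE UU.
  by congr (polar A _); rewrite -ss.
apply: bopP => x; rewrite !bop_compE; congr (polar A _).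
by apply: hdot_ext => y; rewrite (adjE s) [RHS](adjE s) sa adjEr adjE UU.
Qed.

Lemma reduced_eq H K L (X : bounded_op K L) (Y : bounded_op H L)
    (D : bounded_op H K) :
  X ** D = Y -> range D `<=` orthoset (kernel X) -> reduced X Y = D.
Proof.
move=> XD oD.
have [XE oE] := @xgetI _ 0 [set D : bounded_op H K |
  X ** D = Y /\ range D `<=` orthoset (kernel X)] D (conj XD oD).
apply: bopP => x; apply: (@kernel_ortho_inj _ _ _ X).
- by apply: oE; exists x.
- by apply: oD; exists x.
- by rewrite -!bop_compE XE XD.
Qed.

(** Let s be the root of |A22| and U its polar factor. The reduced solutions are E = s Z and F = s
    [adj U] [adj W], so [adj F] E = W U s s Z = W A22 Z. Multiplication by s makes any Z and W
    reduced. *)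
Lemma shorted_eq H1 H2 (S : closed_subspace H1) (T : closed_subspace H2)
    (A : bounded_op H1 H2) (Z : bounded_op (subspace S) (subspace (ortho_csub S)))
    (W : bounded_op (subspace (ortho_csub T)) (subspace T)) :
  block21 S T A = block22 S T A ** Z -> block12 S T A = W ** block22 S T A ->
  shorted S T A =
    incl T ** (block11 S T A - W ** block22 S T A ** Z) ** proj S.
Proof.
move=> ZA WA; rewrite /shorted; set X := block22 S T A in ZA WA *.
have [iU kU AU] := polarP X; have [M0 MM] := abs_opP X.
have [s0 ss] := sqrt_opP M0; set s := sqrt_op (abs_op X) in s0 ss *.
have sa := positive_adj s0.
have AUs x : X x = polar X (s (s x)) by rewrite -(bop_compE s) ss [in LHS]AU.
rewrite sqrt_abs_polar -/s.
have -> : reduced (polar X ** s) (block21 S T A) = s ** Z.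
  apply: reduced_eq; first by rewrite ZA; apply: bopP => x; rewrite !bop_compE -AUs.
  move=> _ [x _ <-] y Usy.
  rewrite bop_compE adjE sa (_ : s y = 0) ?hdot0r//.
  (* From s^3 y = 0 down to s y = 0. *)
  do 2 apply: selfadj_kernel => //.
  rewrite -(bop_compE s s (s y)) ss.
  have : kernel X (s y) by rewrite -kU.
  by rewrite -abs_op_kernel.
have -> : reduced s (adj (block12 S T A)) = s ** adj (polar X) ** adj W.
  apply: reduced_eq.
    apply: bopP => x; apply: hdot_extr => y; rewrite WA adjM !bop_compE.
    by rewrite -[RHS]adjE -[RHS]adjE AUs !adjE sa.
  by move=> _ [x _ <-]; rewrite !bop_compE; exact: selfadj_range_ortho.
congr (_ ** _ ** _); congr (_ - _); apply: bopP => x.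
rewrite !adjM !adjK sa !bop_compE; congr (W _).
exact/esym/AUs.
Qed.

End Polar.

(** * Parallel sums *)

Section ParallelSum.
Variable R : realType.
Implicit Types H K L : hilbertType R.

Lemma proj_left H K (u : hsum H K) :
  val (proj (hsum_left H K) u) = ((u.1, 0) : hsum H K).
Proof.
have Su : (hsum_left H K : set _) ((u.1, 0) : hsum H K) by [].
rewrite -[RHS](proj_id Su); congr val.
apply: proj_eq => y; rewrite (proj_id Su) hsum_hdotE /=.
have y2 : (val y).2 = 0 by exact: (subvalS y).
by rewrite y2 hdot0r subrr hdot0l addr0.
Qed.

Lemma ortho_left H K (u : hsum H K) :
  (ortho_csub (hsum_left H K) : set _) u -> u.1 = 0.
Proof.
move=> ou; apply: hdot_eq0.
have := ou (u.1, 0) erefl; by rewrite hsum_hdotE /= hdot0r addr0.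
Qed.

Lemma proj_right H K (u : hsum H K) :
  val (proj (ortho_csub (hsum_left H K)) u) = ((0, u.2) : hsum H K).
Proof.
have Su : (ortho_csub (hsum_left H K) : set _) ((0, u.2) : hsum H K).
  by move=> y y2; rewrite hsum_hdotE /= (y2 : y.2 = 0) hdot0l hdot0r addr0.
rewrite -[RHS](proj_id Su); congr val.
apply: proj_eq => y; rewrite (proj_id Su) hsum_hdotE /=.
by rewrite (ortho_left (subvalS y)) hdot0r subrr hdot0l addr0.
Qed.

Lemma opmxE H1 H2 K1 K2 (A11 : bounded_op H1 K1) (A12 : bounded_op H2 K1)
    (A21 : bounded_op H1 K2) (A22 : bounded_op H2 K2) (x : hsum H1 H2) :
  opmx A11 A12 A21 A22 x =
  ((A11 x.1 + A12 x.2, A21 x.1 + A22 x.2) : hsum K1 K2).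
Proof. by []. Qed.

Lemma opmx_diag_inj H1 H2 K1 K2 (P Q : bounded_op H1 K1) :
  opmx P 0 0 0 = opmx Q 0 0 0 :> bounded_op (hsum H1 H2) (hsum K1 K2) -> P = Q.
Proof.
move=> PQ; apply: bopP => x.
have := congr1 (fun M : bounded_op (hsum H1 H2) (hsum K1 K2) =>
  (M ((x, 0) : hsum H1 H2)).1) PQ.
by rewrite !opmxE /= !addr0.
Qed.

(** In the matrix defining A : B the lower right block is A + B and the off-diagonal ones are A, so
    its Schur complement is A - W (A + B) Z = A - A Z. *)
Lemma parallel_sum_eq H1 H2 (A B : bounded_op H1 H2)
    (Z : bounded_op H1 H1) (W : bounded_op H2 H2) :
  A = (A + B) ** Z -> A = W ** (A + B) -> parallel_sum A B = A - A ** Z.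
Proof.
move=> AZ WA.
have AZE x : A x = A (Z x) + B (Z x) by rewrite {1}AZ.
have WAE x : A x = W (A x + B x) by rewrite {1}WA.
set M := opmx A A A (A + B).
have ME x : M x = (A x.1 + A x.2, A x.1 + (A x.2 + B x.2)) by [].
suff e : shorted (hsum_left H1 H1) (hsum_left H2 H2) M =
    opmx (A - A ** Z) 0 0 0.
  have := @xgetI _ 0 [set P : bounded_op H1 H2 | opmx P 0 0 0 =
    shorted (hsum_left H1 H1) (hsum_left H2 H2) M] _ (esym e).
  by move=> h; apply: (@opmx_diag_inj H1 H1 H2 H2); rewrite -e; exact: h.
pose z (x : hsum H1 H1) : hsum H1 H1 := (0, Z x.1).
have zE : exists z' : bounded_op (hsum H1 H1) (hsum H1 H1), forall x, z' x = z x.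
  by exists (opmx 0 0 Z 0) => x; rewrite opmxE /z; congr (_, _); rewrite ?addr0.
have wE : exists w' : bounded_op (hsum H2 H2) (hsum H2 H2),
    forall x, w' x = ((W x.2, 0) : hsum H2 H2).
  by exists (opmx 0 W 0 0) => x; rewrite opmxE; congr (_, _); rewrite ?add0r ?addr0.
have [z' {}zE] := zE; have [w' {}wE] := wE.
set S := hsum_left H1 H1; set T := hsum_left H2 H2.
have S1 u : val (proj S u) = (u.1, 0) :> hsum H1 H1 by exact: proj_left.
have S2 u : val (proj (ortho_csub S) u) = (0, u.2) :> hsum H1 H1.
  exact: proj_right.
have T1 u : val (proj T u) = (u.1, 0) :> hsum H2 H2 by exact: proj_left.
have T2 u : val (proj (ortho_csub T) u) = (0, u.2) :> hsum H2 H2.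
  exact: proj_right.
pose Z' : bounded_op (subspace S) (subspace (ortho_csub S)) :=
  proj (ortho_csub S) ** z' ** incl S.
pose W' : bounded_op (subspace (ortho_csub T)) (subspace T) :=
  proj T ** w' ** incl (ortho_csub T).
have x1 (x : subspace (ortho_csub S)) : (val x).1 = 0.
  exact: (ortho_left (subvalS x)).
have x2 (x : subspace S) : (val x).2 = 0 by exact: (subvalS x).
have e21 : block21 S T M = block22 S T M ** Z'.
  apply: bopP => x; apply: val_inj.
  rewrite /block21 /block22 /Z' !bop_compE !inclE !T2 !ME S2 zE /z /=.
  by rewrite x2 !bop_fun0 !addr0 !add0r -AZE.
have e12 : block12 S T M = W' ** block22 S T M.
  apply: bopP => x; apply: val_inj.
  rewrite /block12 /block22 /W' !bop_compE !inclE !T1 !T2 !ME wE /=.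
  by rewrite x1 bop_fun0 !add0r -WAE.
rewrite (shorted_eq e21 e12) -e12; apply: bopP => x.
rewrite opmxE !bop_compE inclE bop_subE subvalB.
rewrite /block11 /block12 /Z' !bop_compE !inclE.
rewrite !T1 !ME S2 S1 zE /z /=.
by rewrite !bop_fun0 !addr0 add0r; congr (_, _); exact: subrr.
Qed.

Lemma parallel_summableP H1 H2 (A B : bounded_op H1 H2) :
  parallel_summable A B <->
  exists (Z : bounded_op H1 H1) (W : bounded_op H2 H2),
    A = (A + B) ** Z /\ A = W ** (A + B).
Proof.
split=> [[]|[Z [W [AZ WA]]]]; last first.
  split=> _ [x _ <-].
    by exists (Z x) => //; rewrite -bop_compE -AZ.
  by exists (adj W x) => //; rewrite -adjD -bop_compE -adjM -WA.
rewrite -adjD => /douglas[Z [AZ _]] /douglas[D [AD _]].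
exists Z, (adj D); split=> //.
by rewrite -{1}(adjK A) -AD adjM adjK.
Qed.

End ParallelSum.

(** * Inverses between subspaces *)

Section RelativeInverse.
Variable R : realType.
Implicit Types H : hilbertType R.

(** [proj] lands in the type of the subspace; as an endomorphism the projection can be used in
    identities between operators on the whole spaces. *)
Definition ortho_proj H (S : closed_subspace H) : bounded_op H H :=
  incl S ** proj S.

Lemma ortho_projE H (S : closed_subspace H) x : ortho_proj S x = val (proj S x).
Proof. by []. Qed.

Lemma ortho_proj_adj H (S : closed_subspace H) : adj (ortho_proj S) = ortho_proj S.
Proof. by rewrite adjM adj_incl adj_proj. Qed.

Lemma ortho_proj_in H (S : closed_subspace H) x : (S : set H) (ortho_proj S x).
Proof. exact: subvalS. Qed.

Lemma ortho_proj_id H (S : closed_subspace H) x :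
  (S : set H) x -> ortho_proj S x = x.
Proof. exact: proj_id. Qed.

Lemma proj_orthoE H (S : closed_subspace H) x :
  val (proj (ortho_csub S) x) = x - ortho_proj S x.
Proof.
have Sx : (ortho_csub S : set H) (x - ortho_proj S x) by exact: proj_ortho.
rewrite -[RHS](proj_id Sx); congr val.
apply: proj_eq => y; rewrite (proj_id Sx) opprB addrC subrK.
by apply: hdot_sym0; apply: (subvalS y); exact: ortho_proj_in.
Qed.

(* K is the inverse of B viewed as a bijection from S onto T, both operators being
   extended by 0 on the orthogonal complements. *)
Definition relative_inverse H1 H2 (S : closed_subspace H1) (T : closed_subspace H2)
    (B : bounded_op H1 H2) (K : bounded_op H2 H1) : Prop :=
  [/\ B ** K = ortho_proj T, K ** B = ortho_proj S,
      ortho_proj T ** B = B & ortho_proj S ** K = K].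

Lemma relative_inverse_sym H1 H2 (S : closed_subspace H1)
    (T : closed_subspace H2) (B : bounded_op H1 H2) (K : bounded_op H2 H1) :
  relative_inverse S T B K -> relative_inverse T S K B.
Proof. by case=> BK KB pB qK; split. Qed.

Lemma relative_inverse_projr H1 H2 (S : closed_subspace H1)
    (T : closed_subspace H2) (B : bounded_op H1 H2) (K : bounded_op H2 H1) :
  relative_inverse S T B K -> B ** ortho_proj S = B.
Proof. by case=> BK KB pB _; rewrite -KB bop_compA BK. Qed.

Section Basics.
Variables (H1 H2 : hilbertType R) (S : closed_subspace H1) (T : closed_subspace H2).
Implicit Types (B X : bounded_op H1 H2) (K : bounded_op H2 H1).

Lemma relative_inverse_adj B K :
  relative_inverse S T B K -> relative_inverse T S (adj B) (adj K).
Proof.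
move=> h; have Bq := relative_inverse_projr h.
have Kp := relative_inverse_projr (relative_inverse_sym h).
case: h => BK KB _ _.
split.
- by rewrite -adjM KB ortho_proj_adj.
- by rewrite -adjM BK ortho_proj_adj.
- by rewrite -{1}(ortho_proj_adj S) -adjM Bq.
- by rewrite -{1}(ortho_proj_adj T) -adjM Kp.
Qed.

Lemma relative_inverse_opp B K :
  relative_inverse S T B K -> relative_inverse S T (- B) (- K).
Proof.
case=> BK KB pB qK.
by split; rewrite ?bop_compNl ?bop_compNr ?opprK ?BK ?KB ?pB ?qK.
Qed.

(** B = B K X = X. The operator is recovered from its inverse, which is how Y = X follows from K' =
    K. *)
Lemma relative_inverse_unique B X K :
  relative_inverse S T B K -> relative_inverse S T X K -> B = X.
Proof.
move=> hB hX; have Bq := relative_inverse_projr hB.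
case: hB => BK _ _ _; case: hX => _ KX pX _.
by rewrite -Bq -KX bop_compA BK.
Qed.

Lemma relative_inverse_range B K :
  relative_inverse S T B K -> range B = T.
Proof.
case=> BK _ pB _; apply/seteqP; split => [_ [x _ <-]|y Ty].
  by rewrite -pB bop_compE; exact: ortho_proj_in.
by exists (K y) => //; rewrite -bop_compE BK ortho_proj_id.
Qed.

(** [douglas] applied to the inclusion of T yields a bounded right inverse with values in the
    orthogonal complement of the kernel, in place of an open mapping argument. *)
Lemma relative_inverse_exists B :
  range B = T -> range (adj B) = S -> exists K, relative_inverse S T B K.
Proof.
move=> BT BS.
have Bq x : B (ortho_proj S x) = B x.
  apply/esym/eqP; rewrite -subr_eq0 -bop_funB.
  have : kernel B (x - ortho_proj S x).
    by rewrite kernel_ortho BS; exact: proj_ortho.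
  by move=> ->.
have oS x : (S : set H1) x -> orthoset (kernel B) x.
  by rewrite -BS => -[y _ <-]; exact: range_adj_ortho.
have TB : range (incl T) `<=` range B.
  by rewrite BT => _ [y _ <-]; exact: subvalS.
have [D [BD oD]] := douglas TB.
have BDE y : B (D y) = val y by rewrite -bop_compE BD.
exists (D ** proj T); split; apply: bopP => x.
- by rewrite !bop_compE BDE.
- rewrite !bop_compE; apply: (@kernel_ortho_inj _ _ _ B).
  + by apply: oD; exists (proj T (B x)).
  + exact/oS/ortho_proj_in.
  + rewrite BDE Bq; apply: ortho_proj_id; rewrite -BT; by exists x.
- by rewrite bop_compE; apply: ortho_proj_id; rewrite -BT; exists x.
- rewrite !bop_compE; apply: (@kernel_ortho_inj _ _ _ B); last exact: Bq.
  + exact/oS/ortho_proj_in.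
  + by apply: oD; exists (proj T x).
Qed.

Lemma nat_scaleK (n : nat) H (x : H) : (0 < n)%N ->
  (n%:R^-1 : R)%:C%C *: (x *+ n) = x.
Proof.
move=> n0; rewrite -(scaler_nat n x) scalerA.
have -> : (n%:R : R[i]) = (n%:R : R)%:C%C by rewrite rmorph_nat.
by rewrite -rmorphM /= mulVf ?pnatr_eq0 -?lt0n// scale1r.
Qed.

Lemma bop_funMn H H' (A : bounded_op H H') x n : A (x *+ n) = A x *+ n.
Proof. exact: raddfMn. Qed.

Lemma relative_inverse_muln B K n : (0 < n)%N -> relative_inverse S T B K ->
  relative_inverse S T (B *+ n) (scale_op H1 (n%:R^-1 : R)%:C%C ** K).
Proof.
move=> n0 [BK KB pB qK]; split; apply: bopP => x.
- rewrite bop_compE bop_MnE bop_compE scale_opE bop_funZ scalerMnr nat_scaleK//.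
  by rewrite -bop_compE BK.
- rewrite !bop_compE bop_MnE bop_funMn scale_opE nat_scaleK//.
  by rewrite -bop_compE KB.
- by rewrite bop_compE bop_MnE bop_funMn -bop_compE pB.
- have KE : (scale_op H1 (n%:R^-1 : R)%:C%C ** K) x = (n%:R^-1 : R)%:C%C *: K x by [].
  by rewrite bop_compE KE bop_funZ -(bop_compE (ortho_proj S)) qK.
Qed.

(** X + nB = n (1 + N) B with N = X K / n, since K B is the projection onto S and X factors through
    it. For n at least twice a bound of X K, N is halving, and the inverse is K J / n with J the
    inverse of 1 + N. *)
Lemma relative_inverse_perturb X B K :
  relative_inverse S T B K -> ortho_proj T ** X = X -> X ** ortho_proj S = X ->
  exists n : nat, (0 < n)%N /\ exists K', relative_inverse S T (X + B *+ n) K'.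
Proof.
move=> hB pX Xq; have Bq := relative_inverse_projr hB.
case: hB => BK KB pB qK.
have [M M0 XM] := nrm_bound (X ** K).
pose n := (Num.Def.archi_bound (2 * M)).+1.
have n0 : (0 < n)%N by [].
have nM : 2 * M <= n%:R.
  have h : 2 * M < (Num.Def.archi_bound (2 * M))%:R.
    by apply: archi_boundP; rewrite mulr_ge0.
  by apply: le_trans (ltW h) _; rewrite ler_nat leqnSn.
pose c : R[i] := (n%:R^-1 : R)%:C%C.
pose N : bounded_op H2 H2 := scale_op H2 c ** (X ** K).
have NE y : N y = c *: X (K y) by [].
have Nle y : nrm (N y) <= 2^-1 * nrm y.
  rewrite NE nrmZr ?invr_ge0// ler_pdivrMl ?ltr0n//.
  apply: le_trans (XM y) _; rewrite mulrA; apply: ler_wpM2r; first exact: nrm_ge0.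
  by rewrite ler_pdivlMr// mulrC.
have [J [NJ JN]] := neumann Nle.
have NJE y : J y + c *: X (K (J y)) = y.
  by have := congr1 (fun A : bounded_op H2 H2 => A y) NJ; rewrite bop_compE bop_addE !id_opE NE.
have JNE y : J (y + c *: X (K y)) = y.
  by have := congr1 (fun A : bounded_op H2 H2 => A y) JN; rewrite bop_compE bop_addE !id_opE NE.
have pE x : ortho_proj T (B x) = B x by rewrite -bop_compE pB.
have pXE x : ortho_proj T (X x) = X x by rewrite -bop_compE pX.
have BKE x : B (K x) = ortho_proj T x by rewrite -bop_compE BK.
have KBE x : K (B x) = ortho_proj S x by rewrite -bop_compE KB.
have qE x : ortho_proj S (K x) = K x by rewrite -bop_compE qK.
have XqE x : X (ortho_proj S x) = X x by rewrite -bop_compE Xq.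
exists n; split=> //; exists (scale_op H1 c ** K ** J).
have KE y : (scale_op H1 c ** K ** J) y = c *: K (J y) by [].
split; apply: bopP => x; rewrite bop_compE.
- rewrite KE bop_addE bop_MnE !bop_funZ scalerMnr nat_scaleK// BKE.
  by rewrite -[in RHS](NJE x) bop_funD bop_funZ pXE addrC.
- rewrite KE bop_addE bop_MnE -{1}(nat_scaleK (X x) n0) -/c.
  have -> : c *: (X x *+ n) + B x *+ n = (B x + c *: X (K (B x))) *+ n.
    by rewrite KBE XqE mulrnDl scalerMnr addrC.
  by rewrite !bop_funMn JNE nat_scaleK// KBE.
- by rewrite bop_addE bop_MnE bop_funD bop_funMn pE pXE.
- by rewrite KE bop_funZ qE.
Qed.

End Basics.

Lemma relative_inverse_comp H1 H2 H3 (S : closed_subspace H1)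
    (T : closed_subspace H2) (V : closed_subspace H3) (B : bounded_op H1 H2)
    (C : bounded_op H2 H3) (K : bounded_op H2 H1) (L : bounded_op H3 H2) :
  relative_inverse S T B K -> relative_inverse T V C L ->
  relative_inverse S V (C ** B) (K ** L).
Proof.
move=> hB hC.
have Cp := relative_inverse_projr hC.
have Kp := relative_inverse_projr (relative_inverse_sym hB).
case: hB => BK KB pB qK; case: hC => CL LC vC pL.
split.
- by rewrite bop_compA -(bop_compA C) BK Cp CL.
- by rewrite bop_compA -(bop_compA K) LC Kp KB.
- by rewrite bop_compA vC.
- by rewrite bop_compA qK.
Qed.

End RelativeInverse.

Section OrthogonalDecomposition.
Variables (R : realType) (H : hilbertType R) (V : closed_subspace H).

Lemma subval0 : val (0 : subspace V) = 0.
Proof. exact: raddf0. Qed.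

Lemma proj_orthocomplement0 u :
  (V : set H) u -> proj (ortho_csub V) u = 0.
Proof.
move=> Vu; apply: val_inj.
by rewrite (raddf0 val) proj_orthoE ortho_proj_id// subrr.
Qed.

Lemma proj_decomposition u :
  u = val (proj V u) + val (proj (ortho_csub V) u).
Proof. by rewrite proj_orthoE addrC subrK. Qed.

End OrthogonalDecomposition.

(** * Complementable operators *)

Section Complementable.
Variables (R : realType) (H1 H2 : hilbertType R).
Variables (S : closed_subspace H1) (T : closed_subspace H2).
Implicit Types A B Q X : bounded_op H1 H2.

Local Notation q := (ortho_proj S).
Local Notation p := (ortho_proj T).

(* With A21 = A22 Z and A12 = W A22, the operators z and w extend Z and W by 0; the
   Schur complement is A (1 - z) restricted to S, and also (1 - w) A compressed to T. *)
Lemma shorted_factor A : complementable S T A ->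
  exists (z : bounded_op H1 H1) (w : bounded_op H2 H2),
  [/\ forall x, q (z x) = 0 /\ z (q x) = z x, forall y, p (w y) = w y, forall y, w (p y) = 0,
      forall x, shorted S T A x = A (q x - z x) &
      forall x, shorted S T A x = p (A x) - w (A x)].
Proof.
case=> /douglas[Z [AZ _]] /douglas[D [AD _]].
have AW : block12 S T A = adj D ** block22 S T A.
  by rewrite -[LHS]adjK -AD adjM adjK.
have sE := shorted_eq (esym AZ) AW.
exists (incl (ortho_csub S) ** Z ** proj S).
exists (incl T ** adj D ** proj (ortho_csub T)).
set z := incl _ ** Z ** _; set w := incl T ** _ ** _.
have zE x : z x = val (Z (proj S x)) by [].
have wE y : w y = val (adj D (proj (ortho_csub T) y)) by [].
have AZE (u : subspace S) : proj (ortho_csub T) (A (val (Z u))) = proj (ortho_csub T) (A (val u)).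
  exact: (congr1 (fun B : bounded_op _ _ => B u) AZ).
have AWE (u : subspace (ortho_csub S)) : proj T (A (val u)) = adj D (proj (ortho_csub T) (A (val u))).
  exact: (congr1 (fun B : bounded_op _ _ => B u) AW).
have sE' x : shorted S T A x =
    val (proj T (A (val (proj S x))) - adj D (proj (ortho_csub T) (A (val (Z (proj S x)))))).
  by rewrite sE.
split.
- move=> x; split; last by rewrite !zE ortho_projE proj_val.
  rewrite zE ortho_projE -(subval0 S); congr val.
  apply: proj_eq => y; rewrite subval0 subr0.
  exact: (subvalS (Z (proj S x))) (subvalS y).
- by move=> y; rewrite wE; apply: ortho_proj_id; exact: subvalS.
- by move=> y; rewrite wE proj_orthocomplement0 ?bop_fun0 ?subval0//; exact: ortho_proj_in.
- move=> x; rewrite sE' -AWE zE ortho_projE -!bop_funB.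
  rewrite [RHS](proj_decomposition T).
  have -> : proj (ortho_csub T) (A (val (proj S x) - val (Z (proj S x)))) = 0.
    by rewrite !bop_funB AZE subrr.
  by rewrite subval0 addr0.
- move=> x; rewrite sE' AZE wE ortho_projE -subvalB; congr val.
  rewrite [in RHS](proj_decomposition S x) !bop_funD AWE.
  by rewrite opprD addrACA subrr addr0.
Qed.

Section ParallelWithInvertible.
Variables (A Q X : bounded_op H1 H2) (K : bounded_op H2 H1).
Variables (z : bounded_op H1 H1) (w : bounded_op H2 H2).
Hypothesis qz : forall x, q (z x) = 0.
Hypothesis pw : forall y, p (w y) = w y.
Hypothesis wp : forall y, w (p y) = 0.
Hypothesis Xz : forall x, X x = A (q x - z x).
Hypothesis Xw : forall x, X x = p (A x) - w (A x).
Hypothesis pQ : p ** Q = Q.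
Hypothesis Qq : Q ** q = Q.
Hypothesis XQK : relative_inverse S T (X + Q) K.

(** For u in S, A + Q sends u - z u to (X + Q) u, because Q z = 0. Solving (A + Q) Z = A therefore
    amounts to solving (X + Q) u = Q x inside S, after which A - A Z sends x to X u. W is the mirror
    image, by w Q = 0. *)
Lemma parallel_with_invertible :
  parallel_summable A Q /\ parallel_sum A Q = X - X ** K ** X.
Proof.
have Dq := relative_inverse_projr XQK.
case: (XQK) => DK KD pD qK.
have pQE x : p (Q x) = Q x by rewrite -bop_compE pQ.
have QqE x : Q (q x) = Q x by rewrite -bop_compE Qq.
have qKE x : q (K x) = K x by rewrite -bop_compE qK.
have DKE x : X (K x) + Q (K x) = p x by rewrite -bop_addE -bop_compE DK.
have KDE x : K (X x + Q x) = q x by rewrite -bop_addE -bop_compE KD.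
have qqE x : q (q x) = q x by apply: ortho_proj_id; exact: ortho_proj_in.
have ppE x : p (p x) = p x by apply: ortho_proj_id; exact: ortho_proj_in.
have pXE x : p (X x) = X x by rewrite Xw bop_funB ppE pw.
have XqE x : X (q x) = X x.
  by apply: (addIr (Q x)); rewrite -{1}QqE -!bop_addE -bop_compE Dq.
have KpE x : K (p x) = K x.
  by rewrite -bop_compE (relative_inverse_projr (relative_inverse_sym XQK)).
have QzE x : Q (z x) = 0 by rewrite -QqE qz bop_fun0.
have wQE x : w (Q x) = 0 by rewrite -pQE wp.
(* This is K Q x, since K (X + Q) = q. *)
pose u x := q x - K (X x).
have qu x : q (u x) = u x by rewrite bop_funB qqE qKE.
have AuE x : A (u x - z (u x)) = X (u x) by rewrite Xz qu.
pose Z : bounded_op H1 H1 := id_op H1 - (id_op H1 - z) ** (q - K ** X).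
pose W : bounded_op H2 H2 := id_op H2 - (p - X ** K) ** (id_op H2 - w).
have ZE x : Z x = x - (u x - z (u x)).
  by rewrite /Z bop_subE id_opE bop_compE bop_subE id_opE.
have WE y : W y = y - (p (y - w y) - X (K (y - w y))).
  by rewrite /W bop_subE id_opE bop_compE bop_subE bop_subE id_opE.
clearbody Z W.
have uE x : u x = q x - K (X x) by [].
clearbody u.
have Xu x : X (u x) + Q (u x) = Q x.
  rewrite uE !bop_funB XqE QqE.
  have e := DKE (X x); rewrite pXE in e.
  by rewrite addrACA -opprD e addrAC subrr add0r.
have AZ : A = (A + Q) ** Z.
  apply: bopP => x; rewrite bop_compE ZE bop_addE bop_funB AuE.
  by rewrite (bop_funB Q) (bop_funB Q (u x)) QzE subr0 addrACA -opprD Xu addrK.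
have WA : A = W ** (A + Q).
  apply: bopP => x; rewrite bop_compE bop_addE WE.
  have pv : p (A x + Q x - w (A x + Q x)) = X x + Q x.
    by rewrite (bop_funD w) wQE addr0 (bop_funB p) (bop_funD p) pw pQE addrAC Xw.
  rewrite -[K _]KpE pv KDE XqE.
  by rewrite [X x + _]addrC addrK addrK.
split; first by apply/parallel_summableP; exists Z, W.
rewrite (parallel_sum_eq AZ WA); apply: bopP => x.
rewrite bop_subE [RHS]bop_subE !bop_compE ZE bop_funB AuE uE bop_funB XqE.
by rewrite opprB addrC subrK.
Qed.

End ParallelWithInvertible.

Lemma parallel_of_inverse Q X K :
  p ** Q = Q -> Q ** q = Q -> relative_inverse S T (Q + X) K ->
  parallel_summable Q X /\ parallel_sum Q X = Q - Q ** K ** Q.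
Proof.
move=> pQ Qq [DK KD pD qK].
have QZ : Q = (Q + X) ** (K ** Q) by rewrite bop_compA DK pQ.
have WQ : Q = Q ** K ** (Q + X) by rewrite -bop_compA KD Qq.
split; first by apply/parallel_summableP; exists (K ** Q), (Q ** K).
by rewrite (parallel_sum_eq QZ WQ) bop_compA.
Qed.

End Complementable.

Theorem proposition6p6 (R : realType) (H1 H2 : hilbertType R)
    (S : closed_subspace H1) (T : closed_subspace H2)
    (A L : bounded_op H1 H2) :
  complementable S T A ->
  range L = T ->
  range (adj L) = S ->
  exists n : nat,
    [/\ (0 < n)%N,
        parallel_summable A (L *+ n),
        sub_class (- (L *+ n)) (shorted S T A),
        sub_class (L *+ n) (parallel_sum A (L *+ n)) &
        parallel_sub (parallel_sum A (L *+ n)) (L *+ n) = shorted S T A].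
Proof.
move=> cA LT LS.
have [z [w [qzq pw wp Xz Xw]]] := shorted_factor cA.
have qz x : ortho_proj S (z x) = 0 by case: (qzq x).
set X := shorted S T A in Xz Xw *.
have [L' hL] := relative_inverse_exists LT LS.
have pX : ortho_proj T ** X = X.
  apply: bopP => x; rewrite bop_compE Xw bop_funB pw; congr (_ - _).
  by apply: ortho_proj_id; exact: ortho_proj_in.
have Xq : X ** ortho_proj S = X.
  apply: bopP => x; rewrite bop_compE !Xz; congr (A (_ - _)).
    by apply: ortho_proj_id; exact: ortho_proj_in.
  by case: (qzq x).
have [n [n0 [K hD]]] := relative_inverse_perturb hL pX Xq.
exists n; set Q := L *+ n in hD *.
have [Q' hQ] : exists Q', relative_inverse S T Q Q'.
  by exists (scale_op H1 (n%:R^-1 : R)%:C%C ** L'); exact: relative_inverse_muln.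
have Qq := relative_inverse_projr hQ.
have [QQ' Q'Q pQ qQ'] := hQ.
have [AQ AQE] := parallel_with_invertible qz pw wp Xz Xw pQ Qq hD.
have hD' : relative_inverse S T (Q + X) K by rewrite addrC.
have [QX QXE] := parallel_of_inverse pQ Qq hD'.
have Dq := relative_inverse_projr hD.
have [DK KD pD qK] := hD.
have CE : parallel_sum A Q = Q - Q ** K ** Q.
  have XE : X = (X + Q) - Q by rewrite addrK.
  have KXE : K ** X = ortho_proj S - K ** Q by rewrite XE bop_compBr KD.
  have XKQ : X ** K ** Q = Q - Q ** K ** Q.
    by rewrite XE bop_compBl DK bop_compBl pQ.
  rewrite AQE -bop_compA KXE bop_compBr Xq bop_compA XKQ.
  by rewrite opprB addrC subrK.
have rangeE B B' K1 K2 : relative_inverse S T B K1 -> relative_inverse S T B' K2 ->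
    range B = range B' /\ range (adj B) = range (adj B').
  move=> h1 h2; rewrite (relative_inverse_range h1) (relative_inverse_range h2).
  by rewrite (relative_inverse_range (relative_inverse_adj h1))
             (relative_inverse_range (relative_inverse_adj h2)).
split => //.
(* The difference to be examined, X - (- Q), is the invertible corner X + Q. *)
- apply: (rangeE _ _ K (- Q')); last exact: relative_inverse_opp.
  by rewrite opprK.
(* By [CE] the difference is - Q K Q, a product of relatively invertible factors. *)
- apply: (rangeE _ _ (- (Q' ** (X + Q) ** Q')) Q') => //.
  rewrite CE addrC addKr; apply: relative_inverse_opp.
  rewrite -[Q' ** _ ** _]bop_compA.
  apply: (relative_inverse_comp hQ).
  exact: (relative_inverse_comp (relative_inverse_sym hD) hQ).
- have ok : [/\ parallel_summable Q X, parallel_sum Q X = parallel_sum A Q,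
      range (Q + X) = range Q & range (adj (Q + X)) = range (adj Q)].
    by have [h1 h2] := rangeE _ _ _ _ hD' hQ; split=> //; rewrite QXE CE.
  (* X satisfies the defining property, so the chosen operator Y does too; what remains is Y = X. *)
  have := @xgetI _ 0 [set X : bounded_op H1 H2 |
    [/\ parallel_summable Q X, parallel_sum Q X = parallel_sum A Q,
        range (Q + X) = range Q & range (adj (Q + X)) = range (adj Q)]] X ok.
  rewrite -/(parallel_sub _ _); move: (parallel_sub _ _) => Y [QY QYE r1 r2].
  have [K' hK'] : exists K', relative_inverse S T (Q + Y) K'.
    apply: relative_inverse_exists; first by rewrite r1 (relative_inverse_range hQ).
    by rewrite r2 (relative_inverse_range (relative_inverse_adj hQ)).
  have [_ QYE'] := parallel_of_inverse pQ Qq hK'.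
  have QKQ : Q ** K' ** Q = Q ** K ** Q.
    by apply: oppr_inj; apply: (addrI Q); rewrite -QYE' QYE CE.
  have sandwich M : relative_inverse S T (Q + X) M \/ relative_inverse S T (Q + Y) M ->
      Q' ** (Q ** M ** Q) ** Q' = M.
    move=> h; have [qM Mp] : ortho_proj S ** M = M /\ M ** ortho_proj T = M.
      by case: h => h; rewrite (relative_inverse_projr (relative_inverse_sym h));
        case: h.
    by rewrite !bop_compA Q'Q qM -bop_compA QQ' Mp.
  have KK' : K' = K.
    by rewrite -(sandwich K' (or_intror hK')) QKQ sandwich//; left.
  rewrite KK' in hK'.
  by apply: (addrI Q); exact: relative_inverse_unique hK' hD'.
Qed.
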